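(* For $\mathsf{c}\in(0,c_0]$, there is no rescaled spectral gap in $[-\mathsf{c},0]$; that is, no rescaled spectral gap $(\mathbf{E}_{\mathrm{max}}^p,\mathbf{E}_{\mathrm{min}}^{p+1})$, $p\ge 0$, intersects $[-\mathsf{c},0]$ (so the only gap in $(-\infty,0]$ is the ''ground state gap'' $(-\infty,\mathbf{E}_{\mathrm{min}}^0)$). The first rescaled spectral gap $(\mathbf{E}_{\mathrm{max}}^0,\mathbf{E}_{\mathrm{min}}^1)$ intersects $[-\mathsf{c},0]$ as soon as $\mathsf{c}>c_0$.
   Context: Let $\hbar,m,L_0,V_0>0$. Let $V$ be the $2L_0$-periodic function on $\mathbb{R}$ with $V(x)=V_0(|x|/L_0-1)$ for $x\in[-L_0,L_0]$, and $H=-\frac{\hbar^2}{2m}\frac{d^2}{dx^2}+V$ acting on the Sobolev space $H^2(\mathbb{R})$ (periodic Airy-Schrödinger operator). Its spectrum is $\sigma(H)=\bigcup_{p\ge 0}[E_{\mathrm{min}}^p,E_{\mathrm{max}}^p]$, where $E_{\mathrm{min}}^0\le E_{\mathrm{max}}^1\le E_{\mathrm{min}}^2\le E_{\mathrm{max}}^3\le\dots$ are the eigenvalues of $-\frac{\hbar^2}{2m}\frac{d^2}{dx^2}+V$ on $[-L_0,L_0]$ with periodic boundary conditions, and $E_{\mathrm{max}}^0\le E_{\mathrm{min}}^1\le E_{\mathrm{max}}^2\le E_{\mathrm{min}}^3\le\dots$ those with antiperiodic boundary conditions. Set $\theta=\left(\frac{2mL_0^2}{\hbar^2V_0^2}\right)^{1/3}$,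 $\mathsf{c}=\theta V_0$, and rescaled edges $\mathbf{E}_{\mathrm{min}}^p=\theta E_{\mathrm{min}}^p$, $\mathbf{E}_{\mathrm{max}}^p=\theta E_{\mathrm{max}}^p$; these depend only on $\mathsf{c}$. The $p$-th rescaled spectral gap is $(\mathbf{E}_{\mathrm{max}}^p,\mathbf{E}_{\mathrm{min}}^{p+1})$. Let $v$ be the solution of the Airy equation $y''=xy$ with $v(0)=0$, $v'(0)=1$; all zeroes of $v'$ are negative and $-c_0$ is the largest one ($c_0\simeq 1.515$). *)

(* Defs.v *)
(* Stdlib real numbers, with Coquelicot's derivatives. *)
From Stdlib Require Import Reals Lra Lia List Arith.
From Coquelicot Require Import Coquelicot.
Open Scope R_scope.

(** The argument is translated into [[-L0, L0)] by a multiple of [2 * L0];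
    see [potential_periodic] and [potential_cell]. *)
Definition potential (L0 V0 x : R) : R :=
  V0 * (Rabs (x - 2 * L0 * IZR (Int_part ((x + L0) / (2 * L0)))) / L0 - 1).

Definition schrodinger (hbar m L0 V0 : R) (psi : R -> R) (x : R) : R :=
  - (hbar ^ 2 / (2 * m)) * Derive_n psi 2 x + potential L0 V0 x * psi x.

(** Boundary conditions are periodic for [sigma = 1] and antiperiodic for
    [sigma = -1].  Since the potential is continuous, eigenfunctions are
    classical solutions; since it is real, real-valued ones suffice to compute
    eigenvalues and multiplicities.  Only the restriction of [psi] to
    [[-L0, L0]] is meaningful: functions that are [C^2] up to the boundary are
    restrictions of functions as below. *)
Definition eigenspace (hbar m L0 V0 sigma E : R) (psi : R -> R) : Prop :=
  (forall x, - L0 <= x <= L0 ->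
     ex_derive psi x /\ ex_derive (Derive psi) x /\
     schrodinger hbar m L0 V0 psi x = E * psi x) /\
  psi L0 = sigma * psi (- L0) /\
  Derive psi L0 = sigma * Derive psi (- L0).

Definition lin_comb (n : nat) (a : nat -> R) (b : nat -> R -> R) (x : R) : R :=
  fold_right Rplus 0 (map (fun k => a k * b k x) (seq 0 n)).

(** The space of restrictions to [[l, r]] of the elements of [S] has
    dimension [n]. *)
Definition has_dim (l r : R) (S : (R -> R) -> Prop) (n : nat) : Prop :=
  exists b : nat -> R -> R,
    (forall k, (k < n)%nat -> S (b k)) /\
    (forall f, S f ->
       exists a, forall x, l <= x <= r -> f x = lin_comb n a b x) /\
    (forall a, (forall x, l <= x <= r -> lin_comb n a b x = 0) ->
       forall k, (k < n)%nat -> a k = 0).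

(** [lambda] lists in nondecreasing order the eigenvalues on [[-L0, L0]], each
    repeated according to its multiplicity (numbers that are not eigenvalues
    have an eigenspace of dimension [0], hence are not listed). *)
Definition eigenvalue_sequence (hbar m L0 V0 sigma : R) (lambda : nat -> R)
    : Prop :=
  (forall k, lambda k <= lambda (S k)) /\
  (forall E, exists ks : list nat,
     NoDup ks /\ (forall k, In k ks <-> lambda k = E) /\
     has_dim (- L0) L0 (eigenspace hbar m L0 V0 sigma E) (length ks)).

Definition band_edges (hbar m L0 V0 : R) (Emin Emax : nat -> R) : Prop :=
  eigenvalue_sequence hbar m L0 V0 1
    (fun p => if Nat.even p then Emin p else Emax p) /\
  eigenvalue_sequence hbar m L0 V0 (-1)
    (fun p => if Nat.even p then Emax p else Emin p).

Definition theta (hbar m L0 V0 : R) : R :=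
  Rpower (2 * m * L0 ^ 2 / (hbar ^ 2 * V0 ^ 2)) (1 / 3).

Definition cpar (hbar m L0 V0 : R) : R := theta hbar m L0 V0 * V0.

(** [eMin] and [eMax] stand for the rescaled band edges. *)
Definition spectral_gap (eMin eMax : nat -> R) (p : nat) (e : R) : Prop :=
  eMax p < e < eMin (S p).

Definition ground_state_gap (eMin : nat -> R) (e : R) : Prop := e < eMin 0%nat.

Definition bands (eMin eMax : nat -> R) (e : R) : Prop :=
  exists p : nat, eMin p <= e <= eMax p.

Definition intersects (A B : R -> Prop) : Prop := exists e, A e /\ B e.

Definition airy_v (v : R -> R) : Prop :=
  (forall x, ex_derive v x /\ is_derive (Derive v) x (x * v x)) /\
  v 0 = 0 /\ Derive v 0 = 1.

Definition largest_zero (f : R -> R) (z : R) : Prop :=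
  f z = 0 /\ forall x, f x = 0 -> x <= z.

Lemma potential_periodic (L0 V0 x : R) :
  0 < L0 -> potential L0 V0 (x + 2 * L0) = potential L0 V0 x.
Proof.
intros HL; unfold potential.
replace ((x + 2 * L0 + L0) / (2 * L0)) with ((x + L0) / (2 * L0) + 1)
  by (field; lra).
set (y := (x + L0) / (2 * L0)).
assert (H : Int_part (y + 1) = (Int_part y + 1)%Z).
{ symmetry; apply Int_part_spec; rewrite plus_IZR.
  destruct (base_Int_part y); lra. }
rewrite H, plus_IZR.
now replace (x + 2 * L0 - 2 * L0 * (IZR (Int_part y) + 1))
  with (x - 2 * L0 * IZR (Int_part y)) by ring.
Qed.

Lemma potential_cell (L0 V0 x : R) :
  0 < L0 -> - L0 <= x <= L0 -> potential L0 V0 x = V0 * (Rabs x / L0 - 1).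
Proof.
intros HL Hx.
assert (H : forall y, - L0 <= y < L0 ->
  potential L0 V0 y = V0 * (Rabs y / L0 - 1)).
{ intros y Hy; unfold potential.
  assert (Hz : Int_part ((y + L0) / (2 * L0)) = 0%Z).
  { symmetry; apply Int_part_spec.
    assert (0 <= (y + L0) / (2 * L0)).
    { apply Rmult_le_pos; [lra | apply Rlt_le, Rinv_0_lt_compat; lra]. }
    assert ((y + L0) / (2 * L0) < 1).
    { apply Rmult_lt_reg_r with (2 * L0); [lra |].
      unfold Rdiv; rewrite Rmult_assoc, Rinv_l; lra. }
    simpl; lra. }
  rewrite Hz; simpl.
  now replace (y - 2 * L0 * 0) with y by ring. }
destruct (Rlt_or_le x L0) as [Hlt | Hge].
- apply H; lra.
- replace x with (- L0 + 2 * L0) by lra.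
  rewrite potential_periodic, H by lra.
  rewrite Rabs_Ropp.
  now replace (- L0 + 2 * L0) with L0 by ring.
Qed.

(* Main.v *)
Require Import Defs.
From Stdlib Require Import Reals Lra Lia List Arith Classical IndefiniteDescription.
From Coquelicot Require Import Coquelicot.
Open Scope R_scope.

(** On each half of the cell the rescaled equation is Airy's equation on
    [[a, a + c]] with [a = - c - e], where [e] is the rescaled energy.  Let [f]
    and [g] be its solutions with [f a = 1, f' a = 0] and [g a = 0, g' a = 1];
    splitting eigenfunctions into even and odd parts, periodic eigenvalues are
    given by [f' (a + c) = 0] or [g (a + c) = 0], and antiperiodic ones by
    [f (a + c) = 0] or [g' (a + c) = 0].

    If [c <= c0] then [v' > 0] on [(- c, oo)].  For [e < 0], Sturm comparison of
    [f] with [v] (the energy [0]) shows that [f] has no zero, hence neither has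
    [g], and comparison of [g] with the other Airy function [u] shows
    [g' (a + c) <> 0].  So antiperiodic eigenvalues are nonnegative; a negative
    periodic eigenvalue has a positive eigenfunction, so there is at most one.

    If [c > c0] then [f] changes sign at energy [0], which produces a negative
    antiperiodic eigenvalue.  The lowest antiperiodic eigenvalue is simple:
    otherwise [f] and [g] would be positive, yet [z f g - f' g'], whose
    derivative is [f g], vanishes at both ends. *)

(** * Zeros of real functions *)

Lemma MVT_is_derive (h dh : R -> R) (a b : R) :
  a < b -> (forall x, a <= x <= b -> is_derive h x (dh x)) ->
  exists x, a < x < b /\ h b - h a = dh x * (b - a).
Proof.
intros Hab Hh.
destruct (MVT_cor2 h dh a b Hab) as [x [H1 H2]].
- intros x Hx; apply is_derive_Reals, Hh, Hx.
- now exists x.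
Qed.

Lemma nondecreasing_is_derive (h dh : R -> R) (a b : R) :
  a <= b -> (forall x, a <= x <= b -> is_derive h x (dh x)) ->
  (forall x, a < x < b -> 0 <= dh x) -> h a <= h b.
Proof.
intros [Hab | ->] Hh Hd; [| lra].
destruct (MVT_is_derive h dh a b Hab Hh) as [x [Hx E]].
specialize (Hd x Hx); nra.
Qed.

Lemma increasing_is_derive (h dh : R -> R) (a b : R) :
  a < b -> (forall x, a <= x <= b -> is_derive h x (dh x)) ->
  (forall x, a < x < b -> 0 < dh x) -> h a < h b.
Proof.
intros Hab Hh Hd.
destruct (MVT_is_derive h dh a b Hab Hh) as [x [Hx E]].
specialize (Hd x Hx); nra.
Qed.

Lemma decreasing_is_derive (h dh : R -> R) (a b : R) :
  a < b -> (forall x, a <= x <= b -> is_derive h x (dh x)) ->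
  (forall x, a < x < b -> dh x < 0) -> h b < h a.
Proof.
intros Hab Hh Hd.
destruct (MVT_is_derive h dh a b Hab Hh) as [x [Hx E]].
specialize (Hd x Hx); nra.
Qed.

Lemma constant_is_derive (h : R -> R) (a b : R) :
  a <= b -> (forall x, a <= x <= b -> is_derive h x 0) -> h b = h a.
Proof.
intros [Hab | ->] Hh; [| reflexivity].
destruct (MVT_is_derive h (fun _ => 0) a b Hab Hh) as [x [Hx E]]; lra.
Qed.

Lemma continuity_is_derive (h : R -> R) (x l : R) :
  is_derive h x l -> continuity_pt h x.
Proof.
intros H; apply derivable_continuous_pt; exists l.
now apply is_derive_Reals.
Qed.

(** The zero is the supremum of the [t] such that [h > 0] on [[a, t]]: by continuity a negative
    value there would spread to the left, and a positive one would push the supremum further. *)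
Lemma first_zero (h : R -> R) (a b : R) :
  (forall x, a <= x <= b -> continuity_pt h x) -> a <= b -> 0 < h a ->
  (forall x, a <= x <= b -> 0 < h x) \/
  exists z, a < z <= b /\ h z = 0 /\ forall x, a <= x < z -> 0 < h x.
Proof.
intros Hc Hab Ha.
destruct (classic (forall x, a <= x <= b -> 0 < h x)) as [H | H]; [now left |].
right.
pose (S := fun t => a <= t <= b /\ forall x, a <= x <= t -> 0 < h x).
assert (Sa : S a).
{ split; [lra |]; intros x Hx; now replace x with a by lra. }
destruct (completeness S) as [z [Hub Hlub]].
{ exists b; intros t [Ht _]; lra. }
{ now exists a. }
assert (az : a <= z) by now apply Hub.
assert (zb : z <= b) by (apply Hlub; intros t [Ht _]; lra).
assert (Hpos : forall x, a <= x < z -> 0 < h x).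
{ intros x Hx.
  destruct (classic (exists t, S t /\ x < t)) as [[t [[Ht1 Ht2] Ht3]] | Hn].
  - apply Ht2; lra.
  - exfalso; assert (z <= x); [| lra].
    apply Hlub; intros t Ht; apply Rnot_lt_le; intros Hlt.
    apply Hn; now exists t. }
assert (Hz : h z = 0).
{ destruct (Rtotal_order (h z) 0) as [Hneg | [H0 | Hp]]; [| exact H0 |];
    exfalso; destruct (Hc z (conj az zb) (Rabs (h z))) as [d [Hd Hdz]];
    try (apply Rabs_pos_lt; lra).
  - destruct (Req_dec a z) as [<- | Hne]; [lra |].
    pose (x := Rmax a (z - d / 2)).
    assert (a <= x < z /\ z - d / 2 <= x).
    { unfold x, Rmax; destruct (Rle_dec a (z - d / 2)); lra. }
    specialize (Hpos x ltac:(lra)).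
    specialize (Hdz x); simpl in Hdz; unfold Rdist in Hdz.
    assert (Hx : Rabs (h x - h z) < Rabs (h z)).
    { apply Hdz; split; [split; [exact I | lra] |].
      apply Rabs_def1; lra. }
    rewrite (Rabs_left (h z)) in Hx by lra.
    apply Rabs_def2 in Hx; lra.
  - assert (Hnear : forall x, a <= x <= z + d / 2 -> 0 < h x).
    { intros x Hx; destruct (Rlt_le_dec x z); [apply Hpos; lra |].
      destruct (Req_dec x z) as [-> | Hne]; [lra |].
      assert (Hx' : Rabs (h x - h z) < Rabs (h z)).
      { apply (Hdz x); split; [split; [exact I | lra] |].
        simpl; unfold Rdist; apply Rabs_def1; lra. }
      rewrite (Rabs_right (h z)) in Hx' by lra.
      apply Rabs_def2 in Hx'; lra. }
    destruct (Rle_lt_dec b (z + d / 2)) as [Hb | Hb].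
    + apply H; intros x Hx; apply Hnear; lra.
    + assert (z + d / 2 <= z); [| lra].
      apply Hub; split; [lra | exact Hnear]. }
exists z; repeat split; auto.
destruct (Req_dec a z) as [<- | Hne]; lra.
Qed.

(** A positive slope would make [h] negative just to the left of [z]. *)
Lemma derivative_at_first_zero (h : R -> R) (a z l : R) :
  a < z -> (forall x, a <= x < z -> 0 < h x) -> h z = 0 -> is_derive h z l ->
  l <= 0.
Proof.
intros Haz Hpos Hz Hd; apply Rnot_lt_le; intros Hl.
apply is_derive_Reals in Hd.
destruct (Hd l Hl) as [[d Hd0] Hd1]; simpl in Hd1.
(* A step to the left, short enough for [z + t] to stay in [[a, z)]. *)
pose (t := - Rmin (z - a) (d / 2)).
assert (Ht : a - z <= t < 0 /\ - d < t).
{ unfold t, Rmin; destruct (Rle_dec (z - a) (d / 2)); lra. }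
specialize (Hd1 t ltac:(lra)).
rewrite Rabs_left in Hd1 by lra.
specialize (Hd1 ltac:(lra)).
specialize (Hpos (z + t) ltac:(lra)).
apply Rabs_def2 in Hd1.
rewrite Hz in Hd1.
assert (E : (h (z + t) - 0) / t * t = h (z + t)) by (field; lra).
nra.
Qed.

Lemma no_zero_pos (h : R -> R) (a b : R) :
  (forall x, a <= x <= b -> continuity_pt h x) -> 0 < h a ->
  (forall x, a <= x <= b -> h x <> 0) -> forall x, a <= x <= b -> 0 < h x.
Proof.
intros Hc Ha Hn x Hx.
destruct (first_zero h a b Hc) as [H | [z [Hz [H0 _]]]]; auto; [lra |].
exfalso; apply (Hn z); [lra | exact H0].
Qed.

(** The minimum of [F . a] depends continuously on [a] by uniform continuity;
    [a] is its first zero. *)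
Lemma first_contact (F : R -> R -> R) (c a0 a1 : R) :
  0 <= c -> a0 <= a1 ->
  (forall s a, continuity_2d_pt F s a) ->
  (forall s, 0 <= s <= c -> 0 < F s a0) ->
  (exists s, 0 <= s <= c /\ F s a1 < 0) ->
  exists a s, a0 < a < a1 /\ 0 <= s <= c /\ F s a = 0 /\
    forall x, 0 <= x <= c -> 0 <= F x a.
Proof.
intros Hc Ha Hcont H0 [s1 [Hs1 Hneg]].
assert (Hmin : forall a, exists s, 0 <= s <= c /\
                 forall x, 0 <= x <= c -> F s a <= F x a).
{ intros a; destruct (continuity_ab_min (fun x => F x a) 0 c Hc) as [s [H1 H2]].
  - intros x Hx eps Heps.
    destruct (Hcont x a (mkposreal eps Heps)) as [d Hd].
    exists d; split; [apply d |]; intros y [_ Hy]; simpl in *; unfold Rdist in *.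
    apply Hd; [exact Hy |].
    replace (a - a) with 0 by ring; rewrite Rabs_R0; apply d.
  - exists s; split; auto. }
apply functional_choice in Hmin as [s Hs].
destruct (first_zero (fun a => F (s a) a) a0 a1) as [H | [z [Hz [Hz0 Hz1]]]].
- intros a _ eps Heps.
  destruct (uniform_continuity_2d F 0 c (a - 1) (a + 1) (fun x y _ _ => Hcont x y)
              (mkposreal eps Heps)) as [d Hd]; simpl in Hd.
  (* The bound 1 keeps [a'] inside the rectangle on which [d] was obtained. *)
  exists (Rmin d 1); split; [apply Rmin_pos; [apply d | lra] |].
  intros a' [_ Ha']; simpl in *; unfold Rdist in *.
  assert (Hd1 : Rabs (a' - a) < d /\ Rabs (a' - a) < 1).
  { split; eapply Rlt_le_trans; try exact Ha'; [apply Rmin_l | apply Rmin_r]. }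
  destruct Hd1 as [Hd1 Hd2]; apply Rabs_def2 in Hd2.
  assert (Hclose : forall x, 0 <= x <= c -> Rabs (F x a' - F x a) < eps).
  { intros x Hx; apply Hd; try lra; auto.
    replace (x - x) with 0 by ring; rewrite Rabs_R0; apply d. }
  destruct (Hs a) as [Hsa Hma], (Hs a') as [Hsa' Hma'].
  pose proof (Hma _ Hsa') as H1; pose proof (Hma' _ Hsa) as H2.
  pose proof (Rabs_def2 _ _ (Hclose _ Hsa)).
  pose proof (Rabs_def2 _ _ (Hclose _ Hsa')).
  apply Rabs_def1; lra.
- exact Ha.
- apply H0, Hs.
- pose proof (H a1 ltac:(lra)); pose proof (proj2 (Hs a1) s1 Hs1); simpl in *; lra.
- assert (z <> a1).
  { intros ->; pose proof (proj2 (Hs a1) s1 Hs1); simpl in *; lra. }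
  exists z, (s z); repeat split; try lra; try apply Hs; auto.
  intros x Hx; pose proof (proj2 (Hs z) x Hx); simpl in *; lra.
Qed.

Lemma interior_zero_minimum (h : R -> R) (a b z l : R) :
  a < z < b -> h z = 0 -> (forall x, a <= x <= b -> 0 <= h x) ->
  is_derive h z l -> l = 0.
Proof.
intros Hz E Hnn Hd; apply is_derive_Reals in Hd.
rewrite <- (derive_pt_eq_0 h z l (exist _ l Hd) Hd).
apply (deriv_minimum h a b); [lra | lra |].
intros x Hx1 Hx2; rewrite E; apply Hnn; lra.
Qed.

(** * Airy functions *)

(** Airy's equation as a first-order system: a solution travels with its derivative. *)
Definition airy (y dy : R -> R) : Prop :=
  forall z, is_derive y z (dy z) /\ is_derive dy z (z * y z).

Definition wronskian (y dy w dw : R -> R) (z : R) : R :=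
  y z * dw z - dy z * w z.

(** Records the derivatives of each Airy pair in the context, then reduces an [is_derive] goal to an
    algebraic identity. Reverting [H] prevents [repeat] from treating the same pair twice. *)
Ltac derive_airy :=
  repeat match goal with
  | H : airy ?y ?dy |- _ =>
      let E := fresh "E" in let F := fresh "F" in
      let G := fresh "G" in let K := fresh "K" in
      assert (E : forall t : R, ex_derive y t)
        by (let t := fresh in intros t; exists (dy t); apply H);
      assert (F : forall t : R, ex_derive dy t)
        by (let t := fresh in intros t; exists (t * y t); apply H);
      assert (G : forall t : R, Derive (fun x => y x) t = dy t)
        by (let t := fresh in intros t; apply is_derive_unique, H);
      assert (K : forall t : R, Derive (fun x => dy x) t = t * y t)
        by (let t := fresh in intros t; apply is_derive_unique, H);
      revert H
  end; intros;
  auto_derive;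
  [ repeat split;
    match goal with E : forall t, ex_derive ?y t |- ex_derive _ _ => apply E end
  | repeat match goal with
    | G : forall t, Derive _ t = _ |- _ => rewrite ?G; clear G
    end ].

Lemma airy_continuity (y dy : R -> R) :
  airy y dy -> forall z, continuity_pt y z /\ continuity_pt dy z.
Proof.
intros H z; destruct (H z).
split; eapply continuity_is_derive; eassumption.
Qed.

Lemma airy_lincomb (y dy w dw : R -> R) (p q : R) :
  airy y dy -> airy w dw ->
  airy (fun z => p * y z + q * w z) (fun z => p * dy z + q * dw z).
Proof.
intros Hy Hw z; split; derive_airy; ring.
Qed.

(** The Sturm comparison identity: as functions of [s], the two solutions obey equations whose
    potentials differ by the constant [q - p], that is, by an energy shift. *)
Lemma is_derive_shifted_wronskian (y dy w dw : R -> R) (p q s : R) :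
  airy y dy -> airy w dw ->
  is_derive (fun s => y (p + s) * dw (q + s) - dy (p + s) * w (q + s)) s
    ((q - p) * (y (p + s) * w (q + s))).
Proof.
intros Hy Hw; derive_airy; ring.
Qed.

Lemma wronskian_constant (y dy w dw : R -> R) :
  airy y dy -> airy w dw ->
  forall z z', wronskian y dy w dw z = wronskian y dy w dw z'.
Proof.
intros Hy Hw.
assert (H : forall z z', z <= z' ->
  wronskian y dy w dw z' = wronskian y dy w dw z).
{ intros z z' Hz; apply constant_is_derive; [exact Hz |].
  intros x _; unfold wronskian; derive_airy; ring. }
intros z z'; destruct (Rle_dec z z') as [Hz | Hz].
- now symmetry; apply H.
- apply H; lra.
Qed.

(** An explicit primitive of the product of two Airy solutions; its increments are their inner
    products. *)
Definition airy_form (y dy w dw : R -> R) (z : R) : R :=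
  z * (y z * w z) - dy z * dw z.

Lemma is_derive_airy_form (y dy w dw : R -> R) (z : R) :
  airy y dy -> airy w dw ->
  is_derive (airy_form y dy w dw) z (y z * w z).
Proof.
intros Hy Hw; unfold airy_form; derive_airy; ring.
Qed.

(** For nonnegative argument [y y'] has derivative [y' ^ 2 + z y ^ 2 >= 0], hence stays nonnegative.
    It is half the derivative of [y ^ 2], and [z] times it is half that of [y' ^ 2]. *)
Lemma airy_growth (y dy : R -> R) (a z : R) :
  airy y dy -> 0 <= a <= z -> 0 <= y a * dy a ->
  y a ^ 2 <= y z ^ 2 /\ dy a ^ 2 <= dy z ^ 2.
Proof.
intros Hy Haz Ha.
assert (Hp : forall t, a <= t -> 0 <= y t * dy t).
{ intros t Ht; apply Rle_trans with (1 := Ha).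
  apply (nondecreasing_is_derive (fun z => y z * dy z)
           (fun z => dy z ^ 2 + z * y z ^ 2)); [exact Ht | |].
  - intros x _; derive_airy; ring.
  - intros x Hx; nra. }
split.
- apply (nondecreasing_is_derive (fun z => y z ^ 2) (fun z => 2 * (y z * dy z)));
    [lra | |].
  + intros x _; derive_airy; ring.
  + intros x Hx; specialize (Hp x ltac:(lra)); lra.
- apply (nondecreasing_is_derive (fun z => dy z ^ 2)
           (fun z => 2 * (z * (y z * dy z)))); [lra | |].
  + intros x _; derive_airy; ring.
  + intros x Hx; specialize (Hp x ltac:(lra)).
    apply Rmult_le_pos; [lra |]; apply Rmult_le_pos; lra.
Qed.

(** * A second Airy function *)

(** Coefficients of the Airy series, as a power series in [z ^ 3]. *)
Fixpoint airy_coeff (n : nat) : R :=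
  match n with
  | O => 1
  | S k => airy_coeff k / ((3 * INR k + 2) * (3 * INR k + 3))
  end.

Lemma airy_coeff_pos (n : nat) : 0 < airy_coeff n.
Proof.
induction n as [| n IH]; simpl; [lra |].
pose proof (pos_INR n).
apply Rdiv_lt_0_compat; [exact IH | apply Rmult_lt_0_compat; lra].
Qed.

Lemma airy_coeff_radius : CV_radius airy_coeff = p_infty.
Proof.
apply CV_radius_infinite_DAlembert.
- intros n; pose proof (airy_coeff_pos n); lra.
- apply is_lim_seq_le_le with (fun _ => 0) (fun n => / INR (S n)).
  + intros n; pose proof (airy_coeff_pos n) as Hn; pose proof (pos_INR n) as HN.
    simpl airy_coeff.
    assert (HD : 0 < (3 * INR n + 2) * (3 * INR n + 3))
      by (apply Rmult_lt_0_compat; lra).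
    split; [apply Rabs_pos |].
    replace (airy_coeff n / ((3 * INR n + 2) * (3 * INR n + 3)) / airy_coeff n)
      with (/ ((3 * INR n + 2) * (3 * INR n + 3))) by (field; lra).
    rewrite Rabs_pos_eq by (apply Rlt_le, Rinv_0_lt_compat, HD).
    rewrite S_INR; apply Rinv_le_contravar; nra.
  + apply is_lim_seq_const.
  + replace (Finite 0) with (Rbar_inv p_infty) by reflexivity.
    apply is_lim_seq_inv; [| discriminate].
    apply -> is_lim_seq_incr_1; apply is_lim_seq_INR.
Qed.

(** This is [y'' = z y] for [y z = P (z ^ 3)], divided by [z] and written with [t = z ^ 3]. On
    coefficients it is the recursion defining [airy_coeff]. *)
Lemma airy_series_ode (t : R) :
  6 * PSeries (PS_derive airy_coeff) t +
  9 * (t * PSeries (PS_derive (PS_derive airy_coeff)) t) =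
  PSeries airy_coeff t.
Proof.
assert (Hex : forall a, CV_radius a = p_infty -> ex_pseries a t).
{ intros a Ha; apply CV_radius_inside; rewrite Ha; exact I. }
rewrite <- PSeries_incr_1, <- !PSeries_scal, <- PSeries_plus.
- apply PSeries_ext; intros n.
  unfold PS_plus, PS_scal, PS_incr_1, PS_derive, plus, scal; cbn -[INR].
  unfold mult; cbn -[INR].
  destruct n as [| n]; cbn -[INR]; rewrite ?S_INR.
  + unfold zero; simpl; field.
  + pose proof (pos_INR n); field; lra.
- apply ex_pseries_scal; [apply Rmult_comm |].
  apply Hex; rewrite CV_radius_derive; apply airy_coeff_radius.
- apply ex_pseries_scal; [apply Rmult_comm |].
  apply ex_pseries_incr_1, Hex.
  rewrite !CV_radius_derive; apply airy_coeff_radius.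
Qed.

(** The theorem is given [v] only; [u] completes it to a basis from which every other solution is
    built. *)
Lemma airy_even_exists : exists u du, airy u du /\ u 0 = 1 /\ du 0 = 0.
Proof.
pose (P := PSeries airy_coeff).
pose (P1 := PSeries (PS_derive airy_coeff)).
pose (P2 := PSeries (PS_derive (PS_derive airy_coeff))).
assert (H1 : forall t, is_derive P t (P1 t)).
{ intros t; apply is_derive_PSeries; rewrite airy_coeff_radius; exact I. }
assert (H2 : forall t, is_derive P1 t (P2 t)).
{ intros t; apply is_derive_PSeries.
  rewrite CV_radius_derive, airy_coeff_radius; exact I. }
assert (E1 : forall t, ex_derive P t) by (intros t; exists (P1 t); apply H1).
assert (E2 : forall t, ex_derive P1 t) by (intros t; exists (P2 t); apply H2).
exists (fun z => P (z * z * z)), (fun z => 3 * z ^ 2 * P1 (z * z * z)).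
split; [intros z; split | split].
- auto_derive; [apply E1 |].
  change (Derive (fun x => P x)) with (Derive P).
  rewrite (is_derive_unique _ _ _ (H1 _)); ring.
- auto_derive; [apply E2 |].
  change (Derive (fun x => P1 x)) with (Derive P1).
  rewrite (is_derive_unique _ _ _ (H2 _)).
  unfold P at 1; rewrite <- airy_series_ode.
  fold P1 P2; ring.
- unfold P; replace (0 * 0 * 0) with 0 by ring.
  now rewrite PSeries_0.
- ring.
Qed.

(** * The Cauchy problem for Airy's equation *)

Definition airy_data (a p q : R) (y dy : R -> R) : Prop :=
  airy y dy /\ y a = p /\ dy a = q.

Lemma wronskian_data (a : R) (f df g dg : R -> R) (z : R) :
  airy_data a 1 0 f df -> airy_data a 0 1 g dg ->
  f z * dg z - df z * g z = 1.
Proof.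
intros [Hf [f0 df0]] [Hg [g0 dg0]].
change (wronskian f df g dg z = 1).
rewrite (wronskian_constant f df g dg Hf Hg z a).
unfold wronskian; rewrite f0, df0, g0, dg0; ring.
Qed.

(** The Wronskians of [y] with [g] and [f] are constant and equal [y a] and, up to sign, [dy a];
    Cramer's rule with determinant 1 recovers [y z]. *)
Lemma airy_cauchy (a : R) (f df g dg y dy : R -> R) :
  airy_data a 1 0 f df -> airy_data a 0 1 g dg -> airy y dy ->
  forall z, y z = y a * f z + dy a * g z.
Proof.
intros Df Dg Hy z.
pose proof (wronskian_data a f df g dg z Df Dg) as W.
destruct Df as [Hf [f0 df0]], Dg as [Hg [g0 dg0]].
pose proof (wronskian_constant y dy g dg Hy Hg z a) as W1.
pose proof (wronskian_constant f df y dy Hf Hy z a) as W2.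
unfold wronskian in W1, W2; rewrite f0, df0 in W2; rewrite g0, dg0 in W1.
replace (y a) with (y z * dg z - dy z * g z) by lra.
replace (dy a) with (f z * dy z - df z * y z) by lra.
transitivity (y z * (f z * dg z - df z * g z)); [rewrite W |]; ring.
Qed.

Lemma airy_data_unique (a p q : R) (f df g dg y dy w dw : R -> R) :
  airy_data a 1 0 f df -> airy_data a 0 1 g dg ->
  airy_data a p q y dy -> airy_data a p q w dw -> forall z, y z = w z.
Proof.
intros Df Dg [Hy [y0 dy0]] [Hw [w0 dw0]] z.
rewrite (airy_cauchy a f df g dg y dy Df Dg Hy).
rewrite (airy_cauchy a f df g dg w dw Df Dg Hw).
now rewrite y0, dy0, w0, dw0.
Qed.

(** As the Wronskian is 1, [g / f] has derivative [1 / f ^ 2] and so increases from 0. *)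
Lemma dirichlet_pos (a b : R) (f df g dg : R -> R) :
  airy_data a 1 0 f df -> airy_data a 0 1 g dg -> a < b ->
  (forall z, a <= z <= b -> 0 < f z) -> 0 < g b.
Proof.
intros Df Dg Hab Hpos.
pose proof (fun z => wronskian_data a f df g dg z Df Dg) as W.
destruct Df as [Hf [f0 df0]], Dg as [Hg [g0 dg0]].
assert (H : g a / f a < g b / f b).
{ apply (increasing_is_derive (fun z => g z / f z) (fun z => / f z ^ 2));
    [exact Hab | |].
  - intros x Hx; specialize (Hpos x Hx).
    evar_last.
    + apply (is_derive_div g f x (dg x) (df x)); [apply Hg | apply Hf | lra].
    + replace (dg x * f x - g x * df x) with 1 by (rewrite <- (W x); ring).
      field; lra.
  - intros x Hx; apply Rinv_0_lt_compat, pow_lt, Hpos; lra. }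
rewrite g0 in H; unfold Rdiv in H; rewrite Rmult_0_l in H.
pose proof (Hpos b ltac:(lra)) as Hb.
replace (g b) with (g b * / f b * f b) by (field; lra).
now apply Rmult_lt_0_compat.
Qed.

(** * Sturm comparison *)

Lemma airy_v_neg (c z : R) (v dv : R -> R) :
  airy_data 0 0 1 v dv -> (forall z, - c < z -> 0 < dv z) ->
  - c <= z < 0 -> v z < 0.
Proof.
intros [Hv [v0 _]] Hdv Hz; rewrite <- v0.
apply (increasing_is_derive v dv); [lra | intros x _; apply Hv |].
intros x Hx; apply Hdv; lra.
Qed.

Lemma limit_nonneg (h : R -> R) (a : R) :
  continuity_pt h a -> (forall z, a < z -> 0 < h z) -> 0 <= h a.
Proof.
intros Hc Hpos; apply Rnot_lt_le; intros Ha.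
destruct (Hc (- h a)) as [d [Hd Hd1]]; [lra |].
specialize (Hd1 (a + d / 2)); simpl in Hd1; unfold Rdist in Hd1.
specialize (Hpos (a + d / 2) ltac:(lra)).
assert (H : Rabs (h (a + d / 2) - h a) < - h a).
{ apply Hd1; split; [split; [exact I | lra] |].
  apply Rabs_def1; lra. }
apply Rabs_def2 in H; lra.
Qed.

(** Sturm comparison of [f (a + s)] with [- v (s - c)], the Dirichlet solution
    at [s = c] for the energy [0]. *)
Lemma neumann_pos (a c : R) (f df v dv : R -> R) :
  airy_data 0 0 1 v dv -> (forall z, - c < z -> 0 < dv z) ->
  0 < c -> 0 < a + c -> airy_data a 1 0 f df ->
  forall s, 0 <= s <= c -> 0 < f (a + s).
Proof.
intros Dv Hdv Hc Hb [Hf [f0 df0]].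
pose proof (fun z => airy_v_neg c z v dv Dv Hdv) as Hneg.
destruct Dv as [Hv [v0 dv0]].
destruct (first_zero (fun s => f (a + s)) 0 c) as [H | [s1 [Hs1 [Hz Hpos]]]].
- intros x _; apply continuity_is_derive with (df (a + x)); derive_airy; ring.
- lra.
- rewrite Rplus_0_r, f0; lra.
- exact H.
- exfalso.
  assert (Hd : df (a + s1) <= 0).
  { apply (derivative_at_first_zero (fun s => f (a + s)) 0 s1); auto; [lra |].
    derive_airy; ring. }
  (* The Wronskian starts at [dv (- c) >= 0] and increases, because [a + c > 0], [f > 0] and
     [v < 0]. At [s1] it is [- df * v] with both factors nonpositive, a contradiction. *)
  assert (H : f (a + 0) * dv (- c + 0) - df (a + 0) * v (- c + 0) <
              f (a + s1) * dv (- c + s1) - df (a + s1) * v (- c + s1)).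
  { apply (increasing_is_derive
      (fun s => f (a + s) * dv (- c + s) - df (a + s) * v (- c + s))
      (fun s => (- c - a) * (f (a + s) * v (- c + s)))); [lra | |].
    - intros x _; now apply is_derive_shifted_wronskian.
    - intros x Hx; specialize (Hpos x ltac:(lra)).
      specialize (Hneg (- c + x) ltac:(lra)).
      assert (0 < f (a + x) * - v (- c + x)) by (apply Rmult_lt_0_compat; lra).
      nra. }
  rewrite !Rplus_0_r, f0, df0, Hz in H.
  assert (0 <= dv (- c)).
  { apply limit_nonneg; [| exact Hdv]; eapply airy_continuity, Hv. }
  assert (v (- c + s1) <= 0).
  { destruct (Req_dec s1 c) as [-> | Hne].
    - replace (- c + c) with 0 by ring; lra.
    - apply Rlt_le, Hneg; lra. }
  nra.
Qed.

(** At the first zero of [u] to the left of 0, [airy_form] of [u] and [v] would be positive: it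
    vanishes at 0 and decreases in between, as [u v < 0]. But there it reduces to [- u' v'] with
    [u'] and [v'] nonnegative. *)
Lemma airy_u_pos (c : R) (u du v dv : R -> R) :
  airy_data 0 1 0 u du -> airy_data 0 0 1 v dv ->
  (forall z, - c < z -> 0 < dv z) -> 0 < c ->
  forall s, 0 <= s <= c -> 0 < u (- s).
Proof.
intros [Hu [u0 du0]] Dv Hdv Hc.
pose proof (fun z => airy_v_neg c z v dv Dv Hdv) as Hneg.
destruct Dv as [Hv [v0 dv0]].
destruct (first_zero (fun s => u (- s)) 0 c) as [H | [s1 [Hs1 [Hz Hpos]]]].
- intros x _; apply continuity_is_derive with (- du (- x)); derive_airy; ring.
- lra.
- rewrite Ropp_0, u0; lra.
- exact H.
- exfalso.
  assert (Hd : - du (- s1) <= 0).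
  { apply (derivative_at_first_zero (fun s => u (- s)) 0 s1); auto; [lra |].
    derive_airy; ring. }
  assert (H : airy_form u du v dv 0 < airy_form u du v dv (- s1)).
  { apply (decreasing_is_derive _ (fun z => u z * v z)); [lra | |].
    - intros x _; now apply is_derive_airy_form.
    - intros x Hx; specialize (Hpos (- x) ltac:(lra)).
      rewrite Ropp_involutive in Hpos.
      specialize (Hneg x ltac:(lra)); nra. }
  unfold airy_form in H; rewrite Hz, u0, du0, v0, dv0 in H.
  assert (0 <= dv (- s1)).
  { apply limit_nonneg; [eapply airy_continuity, Hv |].
    intros z Hz'; apply Hdv; lra. }
  nra.
Qed.

(** Sturm comparison of [g (a + s)] with [u (s - c)], the Neumann solution at
    [s = c] for the energy [0]. *)
Lemma dirichlet_neumann_nonzero (a c : R) (g dg u du v dv : R -> R) :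
  airy_data 0 1 0 u du -> airy_data 0 0 1 v dv ->
  (forall z, - c < z -> 0 < dv z) -> 0 < c -> 0 < a + c ->
  airy_data a 0 1 g dg -> (forall s, 0 < s <= c -> 0 < g (a + s)) ->
  dg (a + c) <> 0.
Proof.
intros Du Dv Hdv Hc Hb [Hg [g0 dg0]] Hpos Hz.
pose proof (airy_u_pos c u du v dv Du Dv Hdv Hc) as Hu0.
destruct Du as [Hu [u0 du0]].
(* If [dg (a + c) = 0], this Wronskian decreases from [- u (- c) < 0] to 0. *)
assert (H : g (a + c) * du (- c + c) - dg (a + c) * u (- c + c) <
            g (a + 0) * du (- c + 0) - dg (a + 0) * u (- c + 0)).
{ apply (decreasing_is_derive
      (fun s => g (a + s) * du (- c + s) - dg (a + s) * u (- c + s))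
      (fun s => (- c - a) * (g (a + s) * u (- c + s)))); [lra | |].
  - intros x _; now apply is_derive_shifted_wronskian.
  - intros x Hx; specialize (Hpos x ltac:(lra)).
    specialize (Hu0 (c - x) ltac:(lra)).
    replace (- (c - x)) with (- c + x) in Hu0 by ring.
    assert (0 < g (a + x) * u (- c + x)) by (apply Rmult_lt_0_compat; lra).
    nra. }
rewrite !Rplus_0_r, g0, dg0, Hz in H.
replace (- c + c) with 0 in H by ring; rewrite du0 in H.
specialize (Hu0 c ltac:(lra)); lra.
Qed.

(** Neumann eigenfunctions for distinct energies are orthogonal, so they cannot both be positive:
    their shifted Wronskian vanishes at both ends but would increase. *)
Lemma positive_neumann_unique (a1 a2 c : R) (f1 df1 f2 df2 : R -> R) :
  0 < c -> a1 < a2 -> airy_data a1 1 0 f1 df1 -> airy_data a2 1 0 f2 df2 ->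
  (forall s, 0 <= s <= c -> 0 < f1 (a1 + s)) ->
  (forall s, 0 <= s <= c -> 0 < f2 (a2 + s)) ->
  df1 (a1 + c) = 0 -> df2 (a2 + c) = 0 -> False.
Proof.
intros Hc Ha [H1 [E1 D1]] [H2 [E2 D2]] P1 P2 Z1 Z2.
assert (H : f1 (a1 + 0) * df2 (a2 + 0) - df1 (a1 + 0) * f2 (a2 + 0) <
            f1 (a1 + c) * df2 (a2 + c) - df1 (a1 + c) * f2 (a2 + c)).
{ apply (increasing_is_derive
      (fun s => f1 (a1 + s) * df2 (a2 + s) - df1 (a1 + s) * f2 (a2 + s))
      (fun s => (a2 - a1) * (f1 (a1 + s) * f2 (a2 + s)))); [lra | |].
  - intros x _; now apply is_derive_shifted_wronskian.
  - intros x Hx; specialize (P1 x ltac:(lra)); specialize (P2 x ltac:(lra)).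
    repeat apply Rmult_lt_0_compat; lra. }
rewrite !Rplus_0_r, D1, D2, Z1, Z2 in H; lra.
Qed.

(** [f] and [g] are orthogonal, because [airy_form f g] vanishes at both
    ends. *)
Lemma positive_not_degenerate (a b : R) (f df g dg : R -> R) :
  a < b -> airy_data a 1 0 f df -> airy_data a 0 1 g dg ->
  (forall z, a <= z < b -> 0 < f z) -> f b = 0 -> dg b = 0 -> False.
Proof.
intros Hab Df Dg Hpos Hf0 Hg0.
assert (Hgpos : forall z, a < z < b -> 0 < g z).
{ intros z Hz; apply (dirichlet_pos a z f df g dg); auto; [lra |].
  intros x Hx; apply Hpos; lra. }
destruct Df as [Hf [f0 df0]], Dg as [Hg [g0 dg0]].
assert (H : airy_form f df g dg a < airy_form f df g dg b).
{ apply (increasing_is_derive _ (fun z => f z * g z)); [lra | |].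
  - intros x _; now apply is_derive_airy_form.
  - intros x Hx; apply Rmult_lt_0_compat; [apply Hpos | apply Hgpos]; lra. }
unfold airy_form in H; rewrite df0, g0, Hf0, Hg0 in H; lra.
Qed.

(** * Varying the left end point *)

Lemma airy_data_exists (u du v dv : R -> R) (a p q : R) :
  airy_data 0 1 0 u du -> airy_data 0 0 1 v dv ->
  airy_data a p q
    (fun z => (p * dv a - q * v a) * u z + (q * u a - p * du a) * v z)
    (fun z => (p * dv a - q * v a) * du z + (q * u a - p * du a) * dv z).
Proof.
intros Du Dv; pose proof (wronskian_data 0 u du v dv a Du Dv) as W.
split; [apply airy_lincomb; [apply Du | apply Dv] | split].
- transitivity (p * (u a * dv a - du a * v a)); [ring | rewrite W; ring].
- transitivity (q * (u a * dv a - du a * v a)); [ring | rewrite W; ring].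
Qed.

(** By [airy_growth], [f ^ 2] never falls below its initial value 1. *)
Lemma nonneg_airy_pos (a c : R) (f df : R -> R) :
  0 <= a -> airy_data a 1 0 f df -> forall s, 0 <= s <= c -> 0 < f (a + s).
Proof.
intros Ha [Hf [f0 df0]].
apply (no_zero_pos (fun s => f (a + s))).
- intros x _; apply continuity_is_derive with (df (a + x)); derive_airy; ring.
- rewrite Rplus_0_r, f0; lra.
- intros s Hs E.
  destruct (airy_growth f df a (a + s) Hf) as [H _]; [lra | |].
  + rewrite df0; lra.
  + rewrite f0, E in H; lra.
Qed.

(** Raising [a] lowers the energy [- a - c]; at the first contact of the graph
    with [0], a zero inside the interval would be a double zero. *)
Lemma neumann_dirichlet_above (a c : R) (f df u du v dv : R -> R) :
  airy_data 0 1 0 u du -> airy_data 0 0 1 v dv -> airy_data a 1 0 f df ->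
  (exists s, 0 <= s <= c /\ f (a + s) < 0) ->
  exists a' y dy, a < a' /\ airy_data a' 1 0 y dy /\ y (a' + c) = 0.
Proof.
intros Du Dv Df Hneg.
pose proof (fun a => airy_data_exists u du v dv a 1 0 Du Dv) as Hdata.
pose proof (fun a => airy_data_exists u du v dv a 0 1 Du Dv) as Hdata'.
(* The value at [- t + s] of the solution with Neumann data at [- t]. The contact is sought from the
   left end [Rabs a], where the solution is positive, down to [a]; hence the parameter [t], opposite
   to the left end. *)
pose (F := fun s t => (1 * dv (- t) - 0 * v (- t)) * u (- t + s) +
                      (0 * u (- t) - 1 * du (- t)) * v (- t + s)).
destruct (first_contact F c (- Rabs a) (- a)) as [t [s [Ht [Hs [Hz Hnn]]]]].
- destruct Hneg as [s [Hs _]]; lra.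
- pose proof (Rle_abs a); lra.
- intros s t; unfold F.
  assert (Hid : continuity_2d_pt (fun _ t => - t) s t).
  { apply continuity_2d_pt_opp, continuity_2d_pt_id2. }
  assert (Hsum : continuity_2d_pt (fun s t => - t + s) s t).
  { apply continuity_2d_pt_plus; [exact Hid | apply continuity_2d_pt_id1]. }
  assert (C1 : forall h, (forall z, continuity_pt h z) ->
                 continuity_2d_pt (fun _ t => h (- t)) s t).
  { intros h Hh; now apply (continuity_1d_2d_pt_comp h (fun _ t => - t)). }
  assert (C2 : forall h, (forall z, continuity_pt h z) ->
                 continuity_2d_pt (fun s t => h (- t + s)) s t).
  { intros h Hh; now apply (continuity_1d_2d_pt_comp h (fun s t => - t + s)). }
  destruct Du as [Hu _], Dv as [Hv _].
  assert (Cu := fun z => proj1 (airy_continuity u du Hu z)).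
  assert (Cdu := fun z => proj2 (airy_continuity u du Hu z)).
  assert (Cv := fun z => proj1 (airy_continuity v dv Hv z)).
  assert (Cdv := fun z => proj2 (airy_continuity v dv Hv z)).
  apply continuity_2d_pt_plus; apply continuity_2d_pt_mult.
  + apply continuity_2d_pt_minus; apply continuity_2d_pt_mult;
      [apply continuity_2d_pt_const | apply (C1 dv Cdv)
      | apply continuity_2d_pt_const | apply (C1 v Cv)].
  + apply (C2 u Cu).
  + apply continuity_2d_pt_minus; apply continuity_2d_pt_mult;
      [apply continuity_2d_pt_const | apply (C1 u Cu)
      | apply continuity_2d_pt_const | apply (C1 du Cdu)].
  + apply (C2 v Cv).
- intros s Hs; unfold F; rewrite Ropp_involutive.
  apply (nonneg_airy_pos (Rabs a) c _ _ (Rabs_pos a) (Hdata (Rabs a))); exact Hs.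
- destruct Hneg as [s [Hs Hneg]]; exists s; split; [exact Hs |].
  unfold F; rewrite Ropp_involutive.
  rewrite <- (airy_data_unique a 1 0 _ _ _ _ _ _ _ _
                (Hdata a) (Hdata' a) Df (Hdata a)).
  exact Hneg.
- specialize (Hdata (- t)); specialize (Hdata' (- t)).
  exists (- t).
  eexists; eexists; split; [lra | split; [exact Hdata |]].
  (* The contact is at [s = c]: at [s = 0] the value is 1, and an interior contact would be a double
     zero, against the Wronskian 1. *)
  destruct (Req_dec s c) as [<- | Hsc]; [exact Hz | exfalso].
  pose proof (wronskian_data (- t) _ _ _ _ (- t + s) Hdata Hdata') as W.
  cbv beta in W.
  change ((1 * dv (- t) - 0 * v (- t)) * u (- t + s) +
          (0 * u (- t) - 1 * du (- t)) * v (- t + s)) with (F s t) in W.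
  rewrite Hz in W.
  destruct (Req_dec s 0) as [-> | Hs0].
  + destruct Hdata as [_ [H1 _]].
    unfold F in Hz; rewrite Rplus_0_r in Hz; lra.
  + assert (Hd : is_derive (fun s => F s t) s
      ((1 * dv (- t) - 0 * v (- t)) * du (- t + s) +
       (0 * u (- t) - 1 * du (- t)) * dv (- t + s))).
    { destruct Du as [Hu _], Dv as [Hv _]; unfold F.
      clear - Hu Hv; derive_airy; ring. }
    rewrite (interior_zero_minimum (fun s => F s t) 0 c s _ ltac:(lra) Hz Hnn Hd)
      in W; lra.
Qed.

(** If [f >= 0] on [[- c, 0]], then [f] is concave there and starts with slope 0, so [f' < 0] at
    [- c0]. The Wronskian with [v] is then [- f' v < 0] at [- c0], yet it equals [f 0 >= 0] at 0. *)
Lemma neumann_changes_sign (c c0 : R) (f df v dv : R -> R) :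
  airy_data 0 0 1 v dv -> dv (- c0) = 0 -> (forall z, - c0 < z -> 0 < dv z) ->
  0 < c0 < c -> airy_data (- c) 1 0 f df ->
  (forall z, f z = 0 -> df z <> 0) ->
  exists s, 0 <= s <= c /\ f (- c + s) < 0.
Proof.
intros Dv Hc0 Hdv Hc [Hf [f0 df0]] Hsimple.
apply NNPP; intros Hn.
assert (Hnn : forall z, - c <= z <= 0 -> 0 <= f z).
{ intros z Hz; apply Rnot_lt_le; intros Hlt; apply Hn.
  exists (z + c); split; [lra |]; now replace (- c + (z + c)) with z by ring. }
pose proof (airy_v_neg c0 (- c0) v dv Dv Hdv ltac:(lra)) as Hvneg.
destruct Dv as [Hv [v0 dv0]].
assert (Hdf : forall x z, - c <= x <= z -> z <= 0 -> df z <= df x).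
{ intros x z Hx Hz.
  apply Ropp_le_cancel.
  apply (nondecreasing_is_derive (fun z => - df z) (fun z => - (z * f z)));
    [lra | intros t _; clear - Hf; derive_airy; ring |].
  intros t Ht; specialize (Hnn t ltac:(lra)); nra. }
assert (Hmono : forall z, - c <= z <= - c0 -> f (- c0) <= f z).
{ intros z Hz; apply Ropp_le_cancel.
  apply (nondecreasing_is_derive (fun z => - f z) (fun z => - df z));
    [lra | intros t _; clear - Hf; derive_airy; ring |].
  intros t Ht; specialize (Hdf (- c) t ltac:(lra) ltac:(lra)); lra. }
(* Strictness: a zero of [f] at [- c0] would be simple; otherwise [f > 0] on [[- c, - c0]], so [f']
   strictly decreases there. *)
assert (Hlt : df (- c0) < 0).
{ destruct (Req_dec (f (- c0)) 0) as [E | Hne].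
  - specialize (Hsimple _ E); specialize (Hdf (- c) (- c0) ltac:(lra) ltac:(lra)).
    lra.
  - rewrite <- df0.
    apply (decreasing_is_derive df (fun z => z * f z)); [lra | |].
    + intros x _; apply Hf.
    + intros x Hx; specialize (Hmono x ltac:(lra)).
      specialize (Hnn (- c0) ltac:(lra)); nra. }
pose proof (wronskian_constant f df v dv Hf Hv (- c0) 0) as W.
unfold wronskian in W; rewrite Hc0, v0, dv0 in W.
specialize (Hnn 0 ltac:(lra)); nra.
Qed.

(** On [[0, oo)], [airy_growth] gives [v' ^ 2 >= 1], so the zero [- c0] is negative; on [(- c0, 0]],
    [v'] has no zero by maximality, and [v' 0 = 1] fixes the sign. *)
Lemma airy_dv_pos (c0 : R) (v dv : R -> R) :
  airy_data 0 0 1 v dv -> largest_zero dv (- c0) ->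
  0 < c0 /\ forall z, - c0 < z -> 0 < dv z.
Proof.
intros [Hv [v0 dv0]] [Hz Hmax].
assert (Hnz : forall z, 0 <= z -> dv z <> 0).
{ intros z Hz' E; destruct (airy_growth v dv 0 z Hv) as [_ H]; [lra | |].
  - rewrite v0; lra.
  - rewrite E, dv0 in H; lra. }
assert (Hc0 : 0 < c0).
{ apply Rnot_le_lt; intros H; apply (Hnz (- c0)); [lra | exact Hz]. }
split; [exact Hc0 |]; intros z Hcz.
destruct (Rle_lt_dec 0 z) as [H0 | H0].
- apply (no_zero_pos dv 0 z); [| lra | | lra].
  + intros x _; apply (airy_continuity v dv Hv).
  + intros x Hx; apply Hnz; lra.
- rewrite <- (Ropp_involutive z).
  apply (no_zero_pos (fun s => dv (- s)) 0 (- z)); [| | | lra].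
  + intros x _; apply continuity_is_derive with (- (- x * v (- x))).
    derive_airy; ring.
  + rewrite Ropp_0; lra.
  + intros x Hx E; specialize (Hmax _ E); lra.
Qed.

(** * Eigenvalues *)

(** Serves to differentiate [f (a + k * |x|)] across the kink of the absolute value. *)
Lemma is_derive_piecewise (p q dp dq : R -> R) :
  (forall x, is_derive p x (dp x)) -> (forall x, is_derive q x (dq x)) ->
  p 0 = q 0 -> dp 0 = dq 0 ->
  forall x, is_derive (fun y => if Rle_dec 0 y then p y else q y) x
              (if Rle_dec 0 x then dp x else dq x).
Proof.
intros Hp Hq E0 E1 x; destruct (Rtotal_order x 0) as [Hx | [-> | Hx]].
- destruct (Rle_dec 0 x); [lra |].
  apply is_derive_ext_loc with q; [| apply Hq].
  apply (locally_interval _ x m_infty 0); simpl; auto.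
  intros y _ Hy; destruct (Rle_dec 0 y); [lra | reflexivity].
- destruct (Rle_dec 0 0) as [_ | n]; [| lra].
  pose proof (Hp 0) as Hp0; pose proof (Hq 0) as Hq0; rewrite <- E1 in Hq0.
  apply is_derive_Reals in Hp0; apply is_derive_Reals in Hq0.
  apply is_derive_Reals; intros eps Heps.
  destruct (Hp0 eps Heps) as [d1 H1], (Hq0 eps Heps) as [d2 H2].
  assert (Hd : 0 < Rmin d1 d2) by (apply Rmin_pos; apply cond_pos).
  exists (mkposreal _ Hd); simpl; intros t Ht Htd.
  pose proof (Rmin_l d1 d2); pose proof (Rmin_r d1 d2).
  destruct (Rle_dec 0 0) as [_ | n]; [| lra].
  destruct (Rle_dec 0 (0 + t)).
  + apply H1; lra.
  + rewrite E0; apply H2; lra.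
- destruct (Rle_dec 0 x); [| lra].
  apply is_derive_ext_loc with p; [| apply Hp].
  apply (locally_interval _ x 0 p_infty); simpl; auto.
  intros y Hy _; destruct (Rle_dec 0 y); [reflexivity | lra].
Qed.

Lemma is_derive_wronskian (y dy w dw : R -> R) (t y1 y2 w1 w2 : R) :
  is_derive y t y1 -> is_derive dy t y2 ->
  is_derive w t w1 -> is_derive dw t w2 ->
  is_derive (fun x => y x * dw x - dy x * w x) t
    ((y1 * dw t + y t * w2) - (y2 * w t + dy t * w1)).
Proof.
intros H1 H2 H3 H4.
apply @is_derive_minus; apply @is_derive_mult; auto; intros; apply Rmult_comm.
Qed.

(** In the variable [a + k * x] the equation is Airy's, so the Wronskian of [psi] with any rescaled
    Airy solution is constant. Taking [f] and [g] gives a linear system of determinant 1 for [psi x]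
    and [dpsi x], up to powers of [k]. *)
Lemma half_cell_cauchy (k a L : R) (f df g dg psi dpsi : R -> R) :
  0 < k -> airy_data a 1 0 f df -> airy_data a 0 1 g dg ->
  (forall x, 0 <= x <= L -> is_derive psi x (dpsi x) /\
     is_derive dpsi x (k ^ 2 * (k * x + a) * psi x)) ->
  forall x, 0 <= x <= L ->
    psi x = psi 0 * f (a + k * x) + dpsi 0 / k * g (a + k * x) /\
    dpsi x = k * (psi 0 * df (a + k * x) + dpsi 0 / k * dg (a + k * x)).
Proof.
intros Hk Df Dg Hpsi x Hx.
pose proof (wronskian_data a f df g dg (a + k * x) Df Dg) as W.
destruct Df as [Hf [f0 df0]], Dg as [Hg [g0 dg0]].
assert (Hconst : forall y dy, airy y dy ->
  psi x * (k * dy (a + k * x)) - dpsi x * y (a + k * x) =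
  psi 0 * (k * dy a) - dpsi 0 * y a).
{ intros y dy Hy.
  transitivity (psi 0 * (k * dy (a + k * 0)) - dpsi 0 * y (a + k * 0)).
  - apply (constant_is_derive
      (fun x => psi x * (k * dy (a + k * x)) - dpsi x * y (a + k * x)));
      [lra |].
    intros t Ht; destruct (Hpsi t ltac:(lra)) as [H1 H2].
    evar_last.
    + apply (is_derive_wronskian psi dpsi (fun x => y (a + k * x))
        (fun x => k * dy (a + k * x)) t _ _ (k * dy (a + k * t))
        (k ^ 2 * ((a + k * t) * y (a + k * t))) H1 H2);
        clear - Hy; derive_airy; ring.
    + ring.
  - now rewrite Rmult_0_r, Rplus_0_r. }
pose proof (Hconst f df Hf) as Ef; pose proof (Hconst g dg Hg) as Eg.
rewrite f0, df0 in Ef; rewrite g0, dg0 in Eg.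
set (F := f (a + k * x)) in *; set (dF := df (a + k * x)) in *.
set (G := g (a + k * x)) in *; set (dG := dg (a + k * x)) in *.
assert (E0 : k * psi 0 = psi x * (k * dG) - dpsi x * G) by lra.
assert (E1 : dpsi 0 = dpsi x * F - psi x * (k * dF)) by lra.
split; apply Rmult_eq_reg_l with k; try lra.
- transitivity (k * psi x * (F * dG - dF * G)); [rewrite W; ring |].
  transitivity (k * psi 0 * F + dpsi 0 * G); [rewrite E0, E1; ring | field; lra].
- transitivity (k * dpsi x * (F * dG - dF * G)); [rewrite W; ring |].
  transitivity (k * (k * psi 0 * dF + dpsi 0 * dG)); [rewrite E0, E1; ring |].
  field; lra.
Qed.

(** * From the Schrodinger operator to Airy's equation *)

Lemma theta_spec (hbar m L0 V0 : R) :
  0 < hbar -> 0 < m -> 0 < L0 -> 0 < V0 ->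
  0 < theta hbar m L0 V0 /\
  theta hbar m L0 V0 ^ 3 = 2 * m * L0 ^ 2 / (hbar ^ 2 * V0 ^ 2).
Proof.
intros Hh Hm HL HV; unfold theta.
assert (0 < 2 * m * L0 ^ 2 / (hbar ^ 2 * V0 ^ 2)).
{ apply Rdiv_lt_0_compat; repeat apply Rmult_lt_0_compat; try lra;
    apply pow_lt; lra. }
split; [apply exp_pos |].
rewrite <- Rpower_pow by apply exp_pos; rewrite Rpower_mult.
replace (1 / 3 * INR 3) with 1 by (simpl; field).
now apply Rpower_1.
Qed.

(** [x |-> left_end + c * |x| / L0] is the Airy variable, which runs over
    [[left_end, left_end + c]] on each half of the cell. *)
Definition left_end (hbar m L0 V0 E : R) : R :=
  - cpar hbar m L0 V0 - theta hbar m L0 V0 * E.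

(** The scale [k] is such that [k ^ 3 = 2 m V0 / (hbar ^ 2 L0)], the slope of the potential after
    division by [hbar ^ 2 / (2 m)]. *)
Lemma schrodinger_airy (hbar m L0 V0 E : R) (psi : R -> R) (x : R) :
  0 < hbar -> 0 < m -> 0 < L0 -> 0 < V0 -> - L0 <= x <= L0 ->
  let k := cpar hbar m L0 V0 / L0 in
  schrodinger hbar m L0 V0 psi x = E * psi x <->
  Derive (Derive psi) x =
    k ^ 2 * (k * Rabs x + left_end hbar m L0 V0 E) * psi x.
Proof.
intros Hh Hm HL HV Hx k.
destruct (theta_spec hbar m L0 V0 Hh Hm HL HV) as [Ht Ht3].
unfold k, left_end, cpar, schrodinger; rewrite potential_cell by assumption.
change (Derive_n psi 2 x) with (Derive (Derive psi) x).
set (th := theta hbar m L0 V0) in *.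
replace ((th * V0 / L0) ^ 2 * (th * V0 / L0 * Rabs x + (- (th * V0) - th * E)))
  with (th ^ 3 * (V0 ^ 2 / L0 ^ 2 * (V0 * (Rabs x / L0 - 1) - E)))
  by (field; lra).
rewrite Ht3.
replace (2 * m * L0 ^ 2 / (hbar ^ 2 * V0 ^ 2) *
         (V0 ^ 2 / L0 ^ 2 * (V0 * (Rabs x / L0 - 1) - E)))
  with (2 * m / hbar ^ 2 * (V0 * (Rabs x / L0 - 1) - E)) by (field; lra).
set (Q := V0 * (Rabs x / L0 - 1)); set (D := Derive (Derive psi) x).
split; intros H.
- assert (H1 : - (hbar ^ 2 / (2 * m)) * D = (E - Q) * psi x) by lra.
  replace D with (- (2 * m / hbar ^ 2) * (- (hbar ^ 2 / (2 * m)) * D))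
    by (field; lra).
  rewrite H1; ring.
- rewrite H; field; lra.
Qed.

(** For [sigma = 1] or [-1], the following are (twice) the boundary value that
    an even, resp. odd, eigenfunction must cancel at [L0]. *)
Definition even_bc (sigma y dy : R) : R := (1 - sigma) * y + (1 + sigma) * dy.
Definition odd_bc (sigma y dy : R) : R := (1 + sigma) * y + (1 - sigma) * dy.

(** On [[0, L0]] both [psi x] and [psi (- x)] solve the same equation, with equal values and
    opposite slopes at 0. Hence [f] carries the even part and [g] the odd part, and the boundary
    conditions decouple. *)
Lemma eigenspace_airy (hbar m L0 V0 sigma E : R) (f df g dg psi : R -> R) :
  0 < hbar -> 0 < m -> 0 < L0 -> 0 < V0 -> sigma = 1 \/ sigma = -1 ->
  let c := cpar hbar m L0 V0 in
  let a := left_end hbar m L0 V0 E in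
  airy_data a 1 0 f df -> airy_data a 0 1 g dg ->
  eigenspace hbar m L0 V0 sigma E psi ->
  exists p q,
    (forall x, 0 <= x <= L0 ->
       psi x = p * f (a + c / L0 * x) + q * g (a + c / L0 * x) /\
       psi (- x) = p * f (a + c / L0 * x) - q * g (a + c / L0 * x)) /\
    p * even_bc sigma (f (a + c)) (df (a + c)) = 0 /\
    q * odd_bc sigma (g (a + c)) (dg (a + c)) = 0.
Proof.
intros Hh Hm HL HV Hsigma c a Df Dg [Hpsi [B0 B1]].
assert (Hk : 0 < c / L0).
{ apply Rdiv_lt_0_compat; [| exact HL].
  apply Rmult_lt_0_compat; [now apply theta_spec | exact HV]. }
assert (HpsiD : forall x, - L0 <= x <= L0 -> is_derive psi x (Derive psi x) /\
  is_derive (Derive psi) x ((c / L0) ^ 2 * (c / L0 * Rabs x + a) * psi x)).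
{ intros x Hx; destruct (Hpsi x Hx) as [H1 [H2 H3]].
  apply schrodinger_airy in H3; auto.
  split; [now apply Derive_correct |].
  unfold c, a; rewrite <- H3; now apply Derive_correct. }
pose proof (half_cell_cauchy (c / L0) a L0 f df g dg psi (Derive psi)
              Hk Df Dg) as Hr.
pose proof (half_cell_cauchy (c / L0) a L0 f df g dg (fun x => psi (- x))
              (fun x => - Derive psi (- x)) Hk Df Dg) as Hl.
cbv beta in Hl; rewrite Ropp_0 in Hl.
assert (Hr' : forall x, 0 <= x <= L0 ->
  is_derive psi x (Derive psi x) /\
  is_derive (Derive psi) x ((c / L0) ^ 2 * (c / L0 * x + a) * psi x)).
{ intros x Hx; destruct (HpsiD x ltac:(lra)) as [H1 H2].
  rewrite Rabs_pos_eq in H2 by lra; now split. }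
specialize (Hr Hr').
assert (Hl' : forall x, 0 <= x <= L0 ->
  is_derive (fun x => psi (- x)) x (- Derive psi (- x)) /\
  is_derive (fun x => - Derive psi (- x)) x
    ((c / L0) ^ 2 * (c / L0 * x + a) * psi (- x))).
{ intros x Hx; destruct (HpsiD (- x) ltac:(lra)) as [H1 H2].
  rewrite Rabs_Ropp, Rabs_pos_eq in H2 by lra.
  assert (Ho : is_derive (fun x : R => - x) x (-1)) by (auto_derive; auto; ring).
  split; evar_last.
  - apply (is_derive_comp psi (fun x => - x) x _ _ H1 Ho).
  - unfold scal; simpl; unfold mult; simpl; ring.
  - apply @is_derive_opp.
    apply (is_derive_comp (Derive psi) (fun x => - x) x _ _ H2 Ho).
  - unfold opp, scal; simpl; unfold mult; simpl; ring. }
specialize (Hl Hl').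
exists (psi 0), (Derive psi 0 / (c / L0)).
split; [intros x Hx; split |].
- apply Hr; exact Hx.
- destruct (Hl x Hx) as [-> _]; unfold Rdiv; ring.
- destruct (Hr L0 ltac:(lra)) as [R0 R1], (Hl L0 ltac:(lra)) as [S0 S1].
  replace (a + c / L0 * L0) with (a + c) in * by (field; lra).
  unfold even_bc, odd_bc.
  set (p := psi 0) in *; set (q := Derive psi 0 / (c / L0)) in *.
  replace (- Derive psi 0 / (c / L0)) with (- q) in * by (unfold q, Rdiv; ring).
  rewrite R0, S0 in B0; rewrite R1 in B1.
  assert (S2 : Derive psi (- L0) =
            c / L0 * (- (p * df (a + c)) + q * dg (a + c))) by lra.
  rewrite S2 in B1.
  assert (B2 : p * df (a + c) + q * dg (a + c) =
               sigma * (- (p * df (a + c)) + q * dg (a + c))).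
  { apply Rmult_eq_reg_l with (c / L0); lra. }
  destruct Hsigma as [-> | ->]; lra.
Qed.

(** * Multiplicities and boundary values *)

Lemma lin_comb_zero (l : list nat) (a : nat -> R) (b : nat -> R -> R) (x : R) :
  (forall k, In k l -> a k = 0) ->
  fold_right Rplus 0 (map (fun k => a k * b k x) l) = 0.
Proof.
induction l as [| k l IH]; intros H; simpl; [reflexivity |].
rewrite IH, H; [ring | now left | intros j Hj; apply H; now right].
Qed.

Lemma has_dim_one (l r : R) (S : (R -> R) -> Prop) (n : nat) :
  has_dim l r S n -> (1 <= n)%nat ->
  exists f x, S f /\ l <= x <= r /\ f x <> 0.
Proof.
intros [b [Hb [_ Hfree]]] Hn.
exists (b 0%nat).
apply NNPP; intros H.
assert (H1 : 1 = 0); [| lra].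
(* With coefficients [1, 0, 0, ...], a vanishing [b 0] would contradict freeness. *)
apply (Hfree (fun k => match k with 0%nat => 1 | _ => 0 end)) with (k := 0%nat);
  [| exact Hn].
intros x Hx.
assert (Hx0 : b 0%nat x = 0).
{ apply NNPP; intros Hne; apply H; exists x; auto. }
destruct n as [| n]; [lia |].
unfold lin_comb; cbn [seq map fold_right]; rewrite lin_comb_zero, Hx0; [ring |].
intros k Hk; apply in_seq in Hk; destruct k; [lia | reflexivity].
Qed.

Lemma has_dim_two (l r : R) (S : (R -> R) -> Prop) (n : nat) :
  has_dim l r S n -> (2 <= n)%nat ->
  exists f g, S f /\ S g /\
    forall p q, (forall x, l <= x <= r -> p * f x + q * g x = 0) ->
      p = 0 /\ q = 0.
Proof.
intros [b [Hb [_ Hfree]]] Hn.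
exists (b 0%nat), (b 1%nat); split; [apply Hb; lia | split; [apply Hb; lia |]].
intros p q Hpq.
assert (H : forall k, (k < n)%nat ->
  match k with 0%nat => p | 1%nat => q | _ => 0 end = 0).
{ apply Hfree; intros x Hx.
  destruct n as [| [| n]]; [lia | lia |].
  unfold lin_comb; cbn [seq map fold_right]; rewrite lin_comb_zero.
  - rewrite Rplus_0_r; now apply Hpq.
  - intros k Hk; apply in_seq in Hk; destruct k as [| [| k]]; lia || reflexivity. }
split; [apply (H 0%nat) | apply (H 1%nat)]; lia.
Qed.

Lemma eigenvalue_bc (hbar m L0 V0 sigma : R) (lambda : nat -> R) (k : nat)
  (f df g dg : R -> R) :
  0 < hbar -> 0 < m -> 0 < L0 -> 0 < V0 -> sigma = 1 \/ sigma = -1 ->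
  let c := cpar hbar m L0 V0 in
  let a := left_end hbar m L0 V0 (lambda k) in
  airy_data a 1 0 f df -> airy_data a 0 1 g dg ->
  eigenvalue_sequence hbar m L0 V0 sigma lambda ->
  even_bc sigma (f (a + c)) (df (a + c)) = 0 \/
  odd_bc sigma (g (a + c)) (dg (a + c)) = 0.
Proof.
intros Hh Hm HL HV Hsigma c a Df Dg [_ Hdim].
destruct (Hdim (lambda k)) as [ks [_ [Hks Hd]]].
assert (Hin : In k ks) by now apply Hks.
apply has_dim_one in Hd as [psi [x [Hpsi [Hx Hne]]]];
  [| destruct ks; [destruct Hin | simpl; lia]].
destruct (eigenspace_airy hbar m L0 V0 sigma (lambda k) f df g dg psi)
  as [p [q [Hrep [Hp Hq]]]]; auto.
apply Rmult_integral in Hp as [-> | Hp]; [| now left].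
apply Rmult_integral in Hq as [-> | Hq]; [| now right].
exfalso; apply Hne.
destruct (Rle_dec 0 x).
- destruct (Hrep x) as [-> _]; [lra | ring].
- destruct (Hrep (- x)) as [_ H]; [lra |].
  rewrite Ropp_involutive in H; rewrite H; ring.
Qed.

(** If one of the two boundary values were nonzero, all eigenfunctions would have the same parity
    and be multiples of a single one. *)
Lemma double_eigenvalue_bc (hbar m L0 V0 sigma : R) (lambda : nat -> R)
  (i j : nat) (f df g dg : R -> R) :
  0 < hbar -> 0 < m -> 0 < L0 -> 0 < V0 -> sigma = 1 \/ sigma = -1 ->
  let c := cpar hbar m L0 V0 in
  let a := left_end hbar m L0 V0 (lambda i) in
  airy_data a 1 0 f df -> airy_data a 0 1 g dg ->
  eigenvalue_sequence hbar m L0 V0 sigma lambda ->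
  i <> j -> lambda j = lambda i ->
  even_bc sigma (f (a + c)) (df (a + c)) = 0 /\
  odd_bc sigma (g (a + c)) (dg (a + c)) = 0.
Proof.
intros Hh Hm HL HV Hsigma c a Df Dg [_ Hdim] Hij Heq.
destruct (Hdim (lambda i)) as [ks [_ [Hks Hd]]].
assert (Hlen : (2 <= length ks)%nat).
{ assert (Hi : In i ks) by now apply Hks.
  assert (Hj : In j ks) by now apply Hks.
  destruct ks as [| k1 [| k2 ks]]; simpl in *; [easy | | lia].
  exfalso; apply Hij; intuition congruence. }
apply has_dim_two in Hd as [psi1 [psi2 [H1 [H2 Hfree]]]]; [| exact Hlen].
destruct (eigenspace_airy hbar m L0 V0 sigma (lambda i) f df g dg psi1)
  as [p1 [q1 [Hr1 [Hp1 Hq1]]]]; auto.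
destruct (eigenspace_airy hbar m L0 V0 sigma (lambda i) f df g dg psi2)
  as [p2 [q2 [Hr2 [Hp2 Hq2]]]]; auto.
assert (Hindep : forall s t, s * p1 + t * p2 = 0 -> s * q1 + t * q2 = 0 ->
                   s = 0 /\ t = 0).
{ intros s t Hp Hq; apply Hfree; intros x Hx.
  assert (Hplus : forall F G,
            s * (p1 * F + q1 * G) + t * (p2 * F + q2 * G) = 0).
  { intros F G; transitivity ((s * p1 + t * p2) * F + (s * q1 + t * q2) * G);
      [| rewrite Hp, Hq]; ring. }
  assert (Hminus : forall F G,
            s * (p1 * F - q1 * G) + t * (p2 * F - q2 * G) = 0).
  { intros F G; rewrite <- (Hplus F (- G)); ring. }
  destruct (Rle_dec 0 x).
  - destruct (Hr1 x) as [-> _]; [lra |]; destruct (Hr2 x) as [-> _]; [lra |].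
    apply Hplus.
  - destruct (Hr1 (- x)) as [_ E1]; [lra |].
    destruct (Hr2 (- x)) as [_ E2]; [lra |].
    rewrite Ropp_involutive in E1, E2; rewrite E1, E2; apply Hminus. }
split; apply NNPP; intros Hne.
- assert (p1 = 0) by (apply Rmult_integral in Hp1 as [? | ?]; easy).
  assert (p2 = 0) by (apply Rmult_integral in Hp2 as [? | ?]; easy).
  subst p1 p2.
  (* [q2 * psi1 - q1 * psi2] vanishes, so [q1 = q2 = 0]; then [psi1] itself vanishes, against
     independence. *)
  destruct (Hindep q2 (- q1)) as [-> Hq1']; [ring | ring |].
  destruct (Hindep 1 0); [ring | nra | lra].
- assert (q1 = 0) by (apply Rmult_integral in Hq1 as [? | ?]; easy).
  assert (q2 = 0) by (apply Rmult_integral in Hq2 as [? | ?]; easy).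
  subst q1 q2.
  destruct (Hindep p2 (- p1)) as [-> Hp1']; [ring | ring |].
  destruct (Hindep 1 0); [nra | ring | lra].
Qed.

Lemma eigenvalue_sequence_le (hbar m L0 V0 sigma : R) (lambda : nat -> R)
  (i j : nat) :
  eigenvalue_sequence hbar m L0 V0 sigma lambda -> (i <= j)%nat ->
  lambda i <= lambda j.
Proof.
intros [Hmono _] Hij; induction Hij as [| j Hij IH]; [lra |].
specialize (Hmono j); lra.
Qed.

(** The even function [f (a + k * |x|)] is an eigenfunction: it vanishes at both ends of the cell,
    and its derivative is odd, hence antiperiodic. *)
Lemma eigenvalue_listed (hbar m L0 V0 E : R) (lambda : nat -> R)
  (f df : R -> R) :
  0 < hbar -> 0 < m -> 0 < L0 -> 0 < V0 ->
  let c := cpar hbar m L0 V0 in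
  let a := left_end hbar m L0 V0 E in
  airy_data a 1 0 f df -> f (a + c) = 0 ->
  eigenvalue_sequence hbar m L0 V0 (-1) lambda ->
  exists k, lambda k = E.
Proof.
intros Hh Hm HL HV c a [Hf [f0 df0]] Hz [_ Hdim].
pose (k := c / L0).
pose (psi := fun x => if Rle_dec 0 x then f (a + k * x) else f (a + k * - x)).
pose (dpsi := fun x =>
  if Rle_dec 0 x then k * df (a + k * x) else - k * df (a + k * - x)).
assert (Ea : a + k * 0 = a /\ a + k * - 0 = a) by (split; ring).
destruct Ea as [Ea1 Ea2].
assert (D1 : forall x, is_derive psi x (dpsi x)).
{ apply (is_derive_piecewise (fun x => f (a + k * x)) (fun x => f (a + k * - x))
    (fun x => k * df (a + k * x)) (fun x => - k * df (a + k * - x))).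
  - intros x; clear - Hf; derive_airy; ring.
  - intros x; clear - Hf; derive_airy; ring.
  - now rewrite Ea1, Ea2.
  - rewrite Ea1, Ea2, df0; ring. }
assert (D2 : forall x, is_derive dpsi x
  (if Rle_dec 0 x then k ^ 2 * ((a + k * x) * f (a + k * x))
   else k ^ 2 * ((a + k * - x) * f (a + k * - x)))).
{ apply (is_derive_piecewise (fun x => k * df (a + k * x))
    (fun x => - k * df (a + k * - x))
    (fun x => k ^ 2 * ((a + k * x) * f (a + k * x)))
    (fun x => k ^ 2 * ((a + k * - x) * f (a + k * - x)))).
  - intros x; clear - Hf; derive_airy; ring.
  - intros x; clear - Hf; derive_airy; ring.
  - rewrite Ea1, Ea2, df0; ring.
  - now rewrite Ea1, Ea2. }
assert (U1 : forall x, Derive psi x = dpsi x)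
  by (intros x; apply is_derive_unique, D1).
assert (D2' : forall x, is_derive (Derive psi) x
  (k ^ 2 * (k * Rabs x + a) * psi x)).
{ intros x; apply is_derive_ext with dpsi; [intros t; symmetry; apply U1 |].
  evar_last; [apply D2 |]; unfold psi.
  destruct (Rle_dec 0 x).
  - rewrite Rabs_pos_eq by lra; ring.
  - rewrite Rabs_left by lra; ring. }
assert (Hpsi : eigenspace hbar m L0 V0 (-1) E psi).
{ assert (EL : a + k * L0 = a + c /\ a + k * - - L0 = a + c)
    by (unfold k; split; field; lra).
  destruct EL as [EL1 EL2].
  split; [intros x Hx; split; [| split] | rewrite !U1; split].
  - eexists; apply D1.
  - eexists; apply D2'.
  - apply schrodinger_airy; auto.
    apply is_derive_unique, D2'.
  - unfold psi; destruct (Rle_dec 0 L0), (Rle_dec 0 (- L0)); try lra.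
    rewrite EL1, EL2, Hz; ring.
  - unfold dpsi; destruct (Rle_dec 0 L0), (Rle_dec 0 (- L0)); try lra.
    rewrite EL1, EL2; ring. }
(* An empty list would mean dimension 0, although [psi 0 = 1]. *)
destruct (Hdim E) as [[| j ks] [_ [Hks [b [_ [Hspan _]]]]]].
- exfalso; destruct (Hspan psi Hpsi) as [w Hw].
  specialize (Hw 0 ltac:(lra)); unfold lin_comb, psi in Hw; simpl in Hw.
  destruct (Rle_dec 0 0); [| lra].
  rewrite Ea1, f0 in Hw; lra.
- exists j; apply Hks; now left.
Qed.

(** * Signs and simplicity of the lowest eigenvalues *)

Lemma cpar_pos (hbar m L0 V0 : R) :
  0 < hbar -> 0 < m -> 0 < L0 -> 0 < V0 -> 0 < cpar hbar m L0 V0.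
Proof.
intros Hh Hm HL HV.
apply Rmult_lt_0_compat; [now apply theta_spec | exact HV].
Qed.

Lemma left_end_neg_energy (hbar m L0 V0 E : R) :
  0 < hbar -> 0 < m -> 0 < L0 -> 0 < V0 -> E < 0 ->
  0 < left_end hbar m L0 V0 E + cpar hbar m L0 V0.
Proof.
intros Hh Hm HL HV HE; unfold left_end.
destruct (theta_spec hbar m L0 V0 Hh Hm HL HV) as [Ht _]; nra.
Qed.

(** Only [df (a + c)] may vanish: it belongs to the even periodic ground state. *)
Lemma negative_energy_bc (a c : R) (f df g dg u du v dv : R -> R) :
  airy_data 0 1 0 u du -> airy_data 0 0 1 v dv ->
  (forall z, - c < z -> 0 < dv z) -> 0 < c -> 0 < a + c ->
  airy_data a 1 0 f df -> airy_data a 0 1 g dg ->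
  f (a + c) <> 0 /\ g (a + c) <> 0 /\ dg (a + c) <> 0.
Proof.
intros Du Dv Hdv Hc Hb Df Dg.
pose proof (neumann_pos a c f df v dv Dv Hdv Hc Hb Df) as Hf.
assert (Hg : forall s, 0 < s <= c -> 0 < g (a + s)).
{ intros s Hs; apply (dirichlet_pos a (a + s) f df g dg Df Dg); [lra |].
  intros z Hz; replace z with (a + (z - a)) by ring; apply Hf; lra. }
split; [| split].
- apply Rgt_not_eq, Hf; lra.
- apply Rgt_not_eq, Hg; lra.
- apply (dirichlet_neumann_nonzero a c g dg u du v dv); auto.
Qed.

Lemma airy_pair_exists (u du v dv : R -> R) (a : R) :
  airy_data 0 1 0 u du -> airy_data 0 0 1 v dv ->
  exists f df g dg, airy_data a 1 0 f df /\ airy_data a 0 1 g dg.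
Proof.
intros Du Dv; do 4 eexists; split; apply airy_data_exists; eassumption.
Qed.

Lemma antiperiodic_nonneg (hbar m L0 V0 : R) (lambda : nat -> R) (k : nat)
  (u du v dv : R -> R) :
  0 < hbar -> 0 < m -> 0 < L0 -> 0 < V0 ->
  airy_data 0 1 0 u du -> airy_data 0 0 1 v dv ->
  (forall z, - cpar hbar m L0 V0 < z -> 0 < dv z) ->
  eigenvalue_sequence hbar m L0 V0 (-1) lambda -> 0 <= lambda k.
Proof.
intros Hh Hm HL HV Du Dv Hdv Hseq; apply Rnot_lt_le; intros Hneg.
pose proof (left_end_neg_energy hbar m L0 V0 _ Hh Hm HL HV Hneg) as Hb.
pose proof (cpar_pos hbar m L0 V0 Hh Hm HL HV) as Hc.
destruct (airy_pair_exists u du v dv (left_end hbar m L0 V0 (lambda k)) Du Dv)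
  as [f [df [g [dg [Df Dg]]]]].
destruct (negative_energy_bc _ _ f df g dg u du v dv Du Dv Hdv Hc Hb Df Dg)
  as [Nf [_ Ndg]].
destruct (eigenvalue_bc hbar m L0 V0 (-1) lambda k f df g dg Hh Hm HL HV
            (or_intror eq_refl) Df Dg Hseq) as [H | H];
  unfold even_bc, odd_bc in H; [apply Nf | apply Ndg]; lra.
Qed.

Lemma second_periodic_nonneg (hbar m L0 V0 : R) (lambda : nat -> R)
  (u du v dv : R -> R) :
  0 < hbar -> 0 < m -> 0 < L0 -> 0 < V0 ->
  airy_data 0 1 0 u du -> airy_data 0 0 1 v dv ->
  (forall z, - cpar hbar m L0 V0 < z -> 0 < dv z) ->
  eigenvalue_sequence hbar m L0 V0 1 lambda -> 0 <= lambda 1%nat.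
Proof.
intros Hh Hm HL HV Du Dv Hdv Hseq; apply Rnot_lt_le; intros Hneg1.
pose proof (cpar_pos hbar m L0 V0 Hh Hm HL HV) as Hc.
set (c := cpar hbar m L0 V0) in *.
pose proof (eigenvalue_sequence_le _ _ _ _ _ _ 0 1 Hseq ltac:(lia)) as Hle.
assert (Hbc : forall k, lambda k < 0 -> exists f df g dg,
  let a := left_end hbar m L0 V0 (lambda k) in
  airy_data a 1 0 f df /\ airy_data a 0 1 g dg /\ df (a + c) = 0 /\
  g (a + c) <> 0 /\ forall s, 0 <= s <= c -> 0 < f (a + s)).
{ intros k Hneg.
  pose proof (left_end_neg_energy hbar m L0 V0 _ Hh Hm HL HV Hneg) as Hb.
  destruct (airy_pair_exists u du v dv (left_end hbar m L0 V0 (lambda k)) Du Dv)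
    as [f [df [g [dg [Df Dg]]]]].
  destruct (negative_energy_bc _ c f df g dg u du v dv Du Dv Hdv Hc Hb Df Dg)
    as [_ [Ng _]].
  exists f, df, g, dg; repeat split; try apply Df; try apply Dg; auto.
  - destruct (eigenvalue_bc hbar m L0 V0 1 lambda k f df g dg Hh Hm HL HV
                (or_introl eq_refl) Df Dg Hseq) as [H | H];
      unfold even_bc, odd_bc in H; fold c in H; [lra | exfalso; apply Ng; lra].
  - now apply (neumann_pos _ c f df v dv Dv Hdv Hc Hb Df). }
destruct (Hbc 0%nat ltac:(lra)) as [f0 [df0 [_ [_ [Df0 [_ [Z0 [_ P0]]]]]]]].
destruct (Hbc 1%nat Hneg1) as [f1 [df1 [g [dg [Df1 [Dg [Z1 [Ng P1]]]]]]]].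
(* A double eigenvalue would also give [g (a + c) = 0]. Distinct ones contradict
   [positive_neumann_unique], where the higher energy has the smaller left end. *)
destruct (Req_dec (lambda 0%nat) (lambda 1%nat)) as [E | Hne].
- destruct (double_eigenvalue_bc hbar m L0 V0 1 lambda 1 0 f1 df1 g dg
              Hh Hm HL HV (or_introl eq_refl) Df1 Dg Hseq) as [_ H]; auto.
  unfold odd_bc in H; apply Ng; unfold c; lra.
- apply (positive_neumann_unique (left_end hbar m L0 V0 (lambda 1%nat))
    (left_end hbar m L0 V0 (lambda 0%nat)) c f1 df1 f0 df0); auto.
  unfold left_end; destruct (theta_spec hbar m L0 V0 Hh Hm HL HV) as [Ht _]; nra.
Qed.

Lemma dirichlet_below (hbar m L0 V0 E : R) (lambda : nat -> R)
  (f df u du v dv : R -> R) :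
  0 < hbar -> 0 < m -> 0 < L0 -> 0 < V0 ->
  airy_data 0 1 0 u du -> airy_data 0 0 1 v dv ->
  let c := cpar hbar m L0 V0 in
  let a := left_end hbar m L0 V0 E in
  airy_data a 1 0 f df -> (exists s, 0 <= s <= c /\ f (a + s) < 0) ->
  eigenvalue_sequence hbar m L0 V0 (-1) lambda -> lambda 0%nat < E.
Proof.
intros Hh Hm HL HV Du Dv c a Df Hneg Hseq.
destruct (theta_spec hbar m L0 V0 Hh Hm HL HV) as [Ht _].
destruct (neumann_dirichlet_above a c f df u du v dv Du Dv Df Hneg)
  as [a' [y [dy [Ha [Dy Hy]]]]].
(* The energy whose left end is [a']; it is below [E] because [a < a']. *)
pose (E' := - (a' + c) / theta hbar m L0 V0).
assert (Ea : a' = left_end hbar m L0 V0 E').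
{ unfold left_end, E'; fold c; field; lra. }
rewrite Ea in Dy, Hy.
destruct (eigenvalue_listed hbar m L0 V0 E' lambda y dy Hh Hm HL HV Dy Hy Hseq)
  as [k Hk].
pose proof (eigenvalue_sequence_le _ _ _ _ _ _ 0 k Hseq ltac:(lia)).
rewrite Ea in Ha; unfold a, left_end in Ha; nra.
Qed.

(** A double eigenvalue forces [f] and [g'] to vanish at the right end. If [f] has no earlier zero,
    [positive_not_degenerate] applies; if it has one, that zero is simple, [f] changes sign, and
    [dirichlet_below] yields a still lower eigenvalue. *)
Lemma first_antiperiodic_simple (hbar m L0 V0 : R) (lambda : nat -> R)
  (u du v dv : R -> R) :
  0 < hbar -> 0 < m -> 0 < L0 -> 0 < V0 ->
  airy_data 0 1 0 u du -> airy_data 0 0 1 v dv ->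
  eigenvalue_sequence hbar m L0 V0 (-1) lambda -> lambda 0%nat < lambda 1%nat.
Proof.
intros Hh Hm HL HV Du Dv Hseq.
pose proof (eigenvalue_sequence_le _ _ _ _ _ _ 0 1 Hseq ltac:(lia)) as Hle.
apply Rnot_le_lt; intros Hge.
pose proof (cpar_pos hbar m L0 V0 Hh Hm HL HV) as Hc.
destruct (airy_pair_exists u du v dv (left_end hbar m L0 V0 (lambda 0%nat)) Du Dv)
  as [f [df [g [dg [Df Dg]]]]].
destruct (double_eigenvalue_bc hbar m L0 V0 (-1) lambda 0 1 f df g dg
            Hh Hm HL HV (or_intror eq_refl) Df Dg Hseq) as [He Ho];
  [easy | lra |].
set (c := cpar hbar m L0 V0) in *.
set (a := left_end hbar m L0 V0 (lambda 0%nat)) in *.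
unfold even_bc in He; unfold odd_bc in Ho.
destruct (first_zero f a (a + c)) as [Hpos | [z [Hz [Hz0 Hpos]]]].
- intros x _; apply (airy_continuity f df (proj1 Df)).
- lra.
- destruct Df as [_ [-> _]]; lra.
- specialize (Hpos (a + c) ltac:(lra)); lra.
- destruct (Req_dec z (a + c)) as [-> | Hne].
  + apply (positive_not_degenerate a (a + c) f df g dg); auto; lra.
  + apply (Rlt_irrefl (lambda 0%nat)).
    apply (dirichlet_below hbar m L0 V0 _ lambda f df u du v dv); auto.
    apply NNPP; intros Hn.
    assert (Hdf : df z = 0).
    { apply (interior_zero_minimum f a (a + c) z); [lra | exact Hz0 | |].
      - intros x Hx; apply Rnot_lt_le; intros Hlt; apply Hn.
        exists (x - a); split; [fold c; lra |].
        fold a; now replace (a + (x - a)) with x by ring.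
      - apply Df. }
    pose proof (wronskian_data a f df g dg z Df Dg) as W.
    rewrite Hz0, Hdf in W; lra.
Qed.

(** Rescaled energies at most [- c] lie below the potential: the Airy variable stays nonnegative,
    and growth keeps [f] and [g'] away from 0. This places the top of the first gap above [- c]. *)
Lemma antiperiodic_lower_bound (hbar m L0 V0 : R) (lambda : nat -> R) (k : nat)
  (u du v dv : R -> R) :
  0 < hbar -> 0 < m -> 0 < L0 -> 0 < V0 ->
  airy_data 0 1 0 u du -> airy_data 0 0 1 v dv ->
  eigenvalue_sequence hbar m L0 V0 (-1) lambda ->
  - cpar hbar m L0 V0 < theta hbar m L0 V0 * lambda k.
Proof.
intros Hh Hm HL HV Du Dv Hseq; apply Rnot_le_lt; intros Hle.
pose proof (cpar_pos hbar m L0 V0 Hh Hm HL HV) as Hc.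
destruct (airy_pair_exists u du v dv (left_end hbar m L0 V0 (lambda k)) Du Dv)
  as [f [df [g [dg [Df Dg]]]]].
assert (Ha : 0 <= left_end hbar m L0 V0 (lambda k)) by (unfold left_end; lra).
destruct (eigenvalue_bc hbar m L0 V0 (-1) lambda k f df g dg Hh Hm HL HV
            (or_intror eq_refl) Df Dg Hseq) as [H | H];
  unfold even_bc, odd_bc in H.
- pose proof (nonneg_airy_pos _ (cpar hbar m L0 V0) f df Ha Df
                (cpar hbar m L0 V0) ltac:(lra)); lra.
- destruct Dg as [Hg [g0 dg0]].
  destruct (airy_growth g dg (left_end hbar m L0 V0 (lambda k))
    (left_end hbar m L0 V0 (lambda k) + cpar hbar m L0 V0) Hg) as [_ H1];
    [lra | rewrite g0; lra |].
  rewrite dg0 in H1; nra.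
Qed.

(** * Gaps for [c] up to [c0] and beyond *)

Theorem theorem1
  (hbar m L0 V0 : R)
  (hbar_pos : 0 < hbar) (m_pos : 0 < m) (L0_pos : 0 < L0) (V0_pos : 0 < V0)
  (Emin Emax : nat -> R)
  (edges : band_edges hbar m L0 V0 Emin Emax)
  (v : R -> R) (hv : airy_v v)
  (c0 : R) (hc0 : largest_zero (Derive v) (- c0)) :
  let c := cpar hbar m L0 V0 in
  let eMin := fun p : nat => theta hbar m L0 V0 * Emin p in
  let eMax := fun p : nat => theta hbar m L0 V0 * Emax p in
  (0 < c <= c0 ->
     (forall p : nat,
        ~ intersects (spectral_gap eMin eMax p) (fun e => - c <= e <= 0)) /\
     (forall e : R, e <= 0 ->
        (~ bands eMin eMax e <-> ground_state_gap eMin e))) /\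
  (c0 < c ->
     intersects (spectral_gap eMin eMax 0%nat) (fun e => - c <= e <= 0)).
Proof.
intros c eMin eMax.
destruct airy_even_exists as [u [du [Hu [u0 du0]]]].
assert (Du : airy_data 0 1 0 u du) by (split; auto).
assert (Dv : airy_data 0 0 1 v (Derive v)).
{ destruct hv as [H [v0 dv0]]; split; [| auto].
  intros z; destruct (H z) as [H1 H2]; split; [| exact H2].
  now apply Derive_correct. }
destruct (airy_dv_pos c0 v (Derive v) Dv hc0) as [Hc0 Hdv].
destruct (theta_spec hbar m L0 V0) as [Ht _]; auto.
destruct edges as [HP HA].
set (lP := fun p => if Nat.even p then Emin p else Emax p) in HP.
set (lA := fun p => if Nat.even p then Emax p else Emin p) in HA.
assert (Hsimple : lA 0%nat < lA 1%nat)
  by now apply (first_antiperiodic_simple hbar m L0 V0 lA u du v (Derive v)).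
split; intros Hc.
- assert (Hdvc : forall z, - cpar hbar m L0 V0 < z -> 0 < Derive v z).
  { intros z Hz; apply Hdv; fold c in Hz; lra. }
  assert (HA0 : forall k, 0 <= lA k).
  { intros k; apply (antiperiodic_nonneg hbar m L0 V0 lA k u du v (Derive v)); auto. }
  assert (HP1 : 0 <= lP 1%nat)
    by (apply (second_periodic_nonneg hbar m L0 V0 lP u du v (Derive v)); auto).
  (* Upper edges are antiperiodic for even [p], and periodic of index at least 1 for odd [p]. *)
  assert (Hmax : forall p, 0 <= eMax p).
  { intros p; apply Rmult_le_pos; [lra |].
    destruct (Nat.even p) eqn:Hp.
    - specialize (HA0 p); unfold lA in HA0; now rewrite Hp in HA0.
    - assert (Hle : lP 1%nat <= lP p).
      { apply (eigenvalue_sequence_le _ _ _ _ _ _ _ _ HP).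
        destruct p; [discriminate | lia]. }
      replace (Emax p) with (lP p) by (unfold lP; now rewrite Hp).
      lra. }
  split.
  + intros p [e [[He1 He2] He3]]; specialize (Hmax p); lra.
  + intros e He; unfold ground_state_gap; split.
    * intros Hn; apply Rnot_le_lt; intros Hle; apply Hn.
      exists 0%nat; specialize (Hmax 0%nat); lra.
    * intros Hlt [p [Hp1 Hp2]].
      destruct (Nat.even p) eqn:Hp.
      -- assert (Hle : lP 0%nat <= lP p).
         { apply (eigenvalue_sequence_le _ _ _ _ _ _ _ _ HP); lia. }
         unfold lP in Hle; rewrite Hp in Hle; simpl in Hle.
         unfold eMin in *; nra.
      (* For odd [p] the lower edge is antiperiodic of index at least 1; the strict inequality
         [lA 0 < lA 1] makes it positive, which excludes [e = 0] as well. *)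
      -- assert (Hle : lA 1%nat <= lA p).
         { apply (eigenvalue_sequence_le _ _ _ _ _ _ _ _ HA).
           destruct p; [discriminate | lia]. }
         specialize (HA0 0%nat).
         assert (HpA : lA p = Emin p) by (unfold lA; now rewrite Hp).
         unfold eMin in *; nra.
- assert (Hneg : lA 0%nat < 0).
  { destruct (airy_pair_exists u du v (Derive v) (- c) Du Dv)
      as [f [df [g [dg [Df Dg]]]]].
    assert (Ea : left_end hbar m L0 V0 0 = - c) by (unfold left_end, c; ring).
    apply (dirichlet_below hbar m L0 V0 0 lA f df u du v (Derive v)); auto;
      rewrite Ea; [exact Df |].
    apply (neumann_changes_sign c c0 f df v (Derive v)); auto; [apply hc0 |].
    intros z Hz Hdz; pose proof (wronskian_data (- c) f df g dg z Df Dg) as W.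
    rewrite Hz, Hdz in W; lra. }
  pose proof (antiperiodic_lower_bound hbar m L0 V0 lA 1 u du v (Derive v)
    hbar_pos m_pos L0_pos V0_pos Du Dv HA) as Hlow.
  fold c in Hlow.
  assert (H0 : eMax 0%nat < 0) by (change (theta hbar m L0 V0 * lA 0%nat < 0); nra).
  assert (H01 : eMax 0%nat < eMin 1%nat)
    by now apply (Rmult_lt_compat_l (theta hbar m L0 V0) (lA 0%nat) (lA 1%nat)).
  change (- c < eMin 1%nat) in Hlow.
  (* The witness is the midpoint of the overlap of the gap with [[- c, 0]]. *)
  pose (lo := Rmax (eMax 0%nat) (- c)); pose (hi := Rmin (eMin 1%nat) 0).
  assert (Hlo : eMax 0%nat <= lo /\ - c <= lo)
    by (split; [apply Rmax_l | apply Rmax_r]).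
  assert (Hhi : hi <= eMin 1%nat /\ hi <= 0)
    by (split; [apply Rmin_l | apply Rmin_r]).
  assert (lo < hi).
  { apply Rmax_lub_lt; apply Rmin_glb_lt; lra. }
  exists ((lo + hi) / 2); unfold spectral_gap; lra.
Qed.
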